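(* For a one-dimensional multi-mode system with discrete costs, an optimal safe infinite schedule can be computed in deterministic logarithmic space.
   Context: A one-dimensional multi-mode system with discrete costs is a tuple $\mathcal{A}=(M,A,\pi_c,\pi_d,V_{\min},V_{\max},V_0)$ where $M$ is a finite set of modes, $A:M\to\mathbb{Q}$ gives the constant rate of change of a single real variable in each mode, $\pi_c:M\to\mathbb{Q}_{\ge0}$ is the cost per time unit in a mode, $\pi_d:M\to\mathbb{Q}_{\ge0}$ is the cost of switching to a mode, $V_{\min}<V_{\max}$ are rationals and $V_0\in[V_{\min},V_{\max}]$. A timed action is a pair $(m,t)$ with $m\in M$, $t>0$. A schedule with infinite time horizon is either an infinite sequence $\langle(m_1,t_1),(m_2,t_2),\dots\rangle$ of timed actions with $\sum_i t_i=\infty$, or a finite sequence $\langle(m_1,t_1),\dots,(m_k,t_k)\rangle$ with $t_k=\infty$. Its run is $V_0,V_1,\dots$ with $V_i=V_{i-1}+t_iA(m_i)$ (for a finite sequence ending with $t_k=\infty$ this requires the variable to stay constant or the last point to be interpreted along the infinite action); it is safe if the variable stays in $[V_{\min},V_{\max}]$ at all times. The limit-average cost of a finite schedule with $t_k=\infty$ is $\pi_c(m_k)$, and of an infinite schedule is $\limsup_{k\to\infty}\frac{\sum_{i=1}^k\pi_d(m_i)+\pi_c(m_i)t_i}{\sum_{i=1}^k t_i}$. A safe infinite schedule is optimal if no safe infinite schedule has smaller limit-average cost. *)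

(* Defs.v *)
From HB Require Import structures.
From mathcomp Require Import all_boot all_order all_algebra.
From mathcomp Require Import all_classical all_reals all_analysis.

Set Implicit Arguments.
Unset Strict Implicit.
Unset Printing Implicit Defensive.

Import Order.TTheory GRing.Theory Num.Theory.

Inductive move := MoveLeft | MoveStay | MoveRight.

Definition shift (d : move) (p : nat) : nat :=
  match d with MoveLeft => p.-1 | MoveStay => p | MoveRight => p.+1 end.

(* The input word is surrounded by two end markers. *)
Inductive icell (Sin : Type) := LeftEnd | Letter of Sin | RightEnd.
Arguments LeftEnd {Sin}.
Arguments RightEnd {Sin}.

(* A deterministic multi-tape Turing machine with a read-only two-way input
   tape, [ntapes] read-write work tapes (infinite to the right), and a
   write-only output tape, to which a step appends at most one letter. *)
Record transducer (Sin Sout : finType) := Transducer {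
  state : finType;
  ntapes : nat;
  wsym : finType;
  blank : wsym;
  start : state;
  halting : pred state;
  delta : state -> icell Sin -> {ffun 'I_ntapes -> wsym} ->
          state * move * {ffun 'I_ntapes -> wsym * move} * option Sout
}.

Section Run.
Variables (Sin Sout : finType) (T : transducer Sin Sout) (w : seq Sin).

Record config := Config {
  cstate : state T;
  ipos : nat;
  wtape : 'I_(ntapes T) -> nat -> wsym T;
  wpos : 'I_(ntapes T) -> nat;
  output : seq Sout
}.

(* Cell 0 holds the left end marker, cells 1, ..., size w the input word. *)
Definition icell_at (p : nat) : icell Sin :=
  if p is p'.+1 then
    (if onth w p' is Some a then Letter a else RightEnd)
  else LeftEnd.

Definition init : config :=
  Config (start T) 0 (fun _ _ => blank T) (fun _ => 0) [::].

(* The input head cannot leave the cells 0, ..., (size w).+1; a left move of a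
   work head on cell 0 leaves it there. *)
Definition step (c : config) : config :=
  if halting (cstate c) then c else
  let: (q, d, a, o) :=
    delta (cstate c) (icell_at (ipos c))
          [ffun i => wtape c i (wpos c i)] in
  Config q
    (minn (shift d (ipos c)) (size w).+1)
    (fun i p => if p == wpos c i then (a i).1 else wtape c i p)
    (fun i => shift (a i).2 (wpos c i))
    (output c ++ seq_of_opt o).

Definition run (n : nat) : config := iter n step init.

Definition halts : Prop := exists n, halting (cstate (run n)).

Definition outputs (v : seq Sout) : Prop :=
  exists n, halting (cstate (run n)) /\ output (run n) = v.

Definition space_le (s : nat) : Prop :=
  forall n (i : 'I_(ntapes T)), wpos (run n) i < s.

End Run.

(* Space c * (log n + 1) on every input of length n, well-formed or not. *)
Definition logspace (Sin Sout : finType) (T : transducer Sin Sout) : Prop :=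
  exists c : nat, forall w : seq Sin,
    halts T w /\ space_le T w (c * (trunc_log 2 (size w)).+1).

(* The search problem that asks, given any code of an instance [x], for a word
   [v] such that [sol x v]. *)
Definition logspace_solvable (Sin Sout : finType) (X : Type)
    (code : X -> seq Sin -> Prop) (sol : X -> seq Sout -> Prop) : Prop :=
  exists T : transducer Sin Sout, logspace T /\
    forall x w, code x w -> exists v, outputs T w v /\ sol x v.

Local Open Scope ring_scope.

Record system := System {
  mode : finType;
  rate : mode -> rat;
  cost_c : mode -> rat;
  cost_d : mode -> rat;
  vmin : rat;
  vmax : rat;
  v0 : rat;
  cost_c_ge0 : forall m, 0 <= cost_c m;
  cost_d_ge0 : forall m, 0 <= cost_d m;
  vmin_lt_vmax : vmin < vmax;
  v0_in : vmin <= v0 <= vmax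
}.

(* [Forever p m] is the finite sequence [p] of timed actions followed by
   the timed action of mode [m] with infinite duration. *)
Inductive schedule (R : realType) (S : system) :=
  | Infinite of (nat -> mode S * R)
  | Forever of seq (mode S * R) & mode S.

Section Schedules.
Variables (R : realType) (S : system).
Implicit Types (a : nat -> mode S * R) (s : schedule R S).

Definition is_schedule s : Prop :=
  match s with
  | Infinite a =>
      (forall i, 0 < (a i).2) /\ (\sum_(0 <= i <oo) (a i).2%:E = +oo)%E
  | Forever p _ => forall x, x \in p -> 0 < x.2
  end.

Definition var a (k : nat) : R :=
  ratr (v0 S) + \sum_(i < k) (a i).2 * ratr (rate (a i).1).

Definition in_range (x : R) : Prop := ratr (vmin S) <= x <= ratr (vmax S).

Definition stays_safe a (k : nat) (t : R) : Prop :=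
  in_range (var a k + t * ratr (rate (a k).1)).

Definition safe s : Prop :=
  match s with
  | Infinite a => forall k t, 0 <= t <= (a k).2 -> stays_safe a k t
  | Forever p m =>
      let a := nth (m, 0) p in
      (forall k t, (k < size p)%N -> 0 <= t <= (a k).2 -> stays_safe a k t) /\
      (forall t, 0 <= t -> stays_safe a (size p) t)
  end.

Definition average_cost a (k : nat) : R :=
  (\sum_(i < k) (ratr (cost_d (a i).1) + ratr (cost_c (a i).1) * (a i).2))
  / \sum_(i < k) (a i).2.

Definition limit_average_cost s : \bar R :=
  match s with
  | Infinite a => limn_esup (fun k => (average_cost a k.+1)%:E)
  | Forever _ m => (ratr (cost_c m))%:E
  end.

Definition safe_schedule s : Prop := is_schedule s /\ safe s.

Definition optimal s : Prop :=
  safe_schedule s /\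
  ~ exists s', safe_schedule s' /\
               (limit_average_cost s' < limit_average_cost s)%E.

End Schedules.

(* [Lasso p x c] performs the actions of [p] and then repeats those of
   [x :: c] for ever. *)
Inductive description (S : system) :=
  | Lasso of seq (mode S * rat) & mode S * rat & seq (mode S * rat)
  | Final of seq (mode S * rat) & mode S.

Definition described (R : realType) (S : system) (D : description S) :
    schedule R S :=
  let real (x : mode S * rat) : mode S * R := (x.1, ratr x.2) in
  match D with
  | Lasso p x c =>
      Infinite (fun i => real
        (if (i < size p)%N then nth x p i
         else nth x (x :: c) ((i - size p) %% (size c).+1)))
  | Final p m => Forever (map real p) m
  end.

Inductive symbol :=
  Bit of bool | Minus | Slash | Comma | Semicolon | Bar | Infty.

Definition symbol_to (x : symbol) : bool + 'I_6 :=
  match x with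
  | Bit b => inl b
  | Minus => inr (inord 0)
  | Slash => inr (inord 1)
  | Comma => inr (inord 2)
  | Semicolon => inr (inord 3)
  | Bar => inr (inord 4)
  | Infty => inr (inord 5)
  end.

Definition symbol_of (x : bool + 'I_6) : symbol :=
  match x with
  | inl b => Bit b
  | inr i => nth Minus [:: Minus; Slash; Comma; Semicolon; Bar; Infty] i
  end.

Lemma symbol_toK : cancel symbol_to symbol_of.
Proof. by case=> //=; rewrite inordK. Qed.

HB.instance Definition _ := Finite.copy symbol (can_type symbol_toK).

Definition word := seq symbol.

(* Binary numerals, most significant bit first; leading zeros are allowed. *)
Definition nat_code (n : nat) (w : word) : Prop :=
  exists b : seq bool,
    [/\ b != [::], foldl (fun k (x : bool) => (k.*2 + x)%N) 0%N b = n
      & w = map Bit b].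

(* Fractions need not be in lowest terms, neither in the input nor in the
   output. *)
Definition rat_code (r : rat) (w : word) : Prop :=
  exists (s : bool) (p q : nat) (wp wq : word),
    [/\ nat_code p wp, nat_code q wq, (0 < q)%N,
        r = (-1) ^+ s * (p%:R / q%:R)
      & w = nseq s Minus ++ wp ++ Slash :: wq].

Definition mode_code (S : system) (m : mode S) (w : word) : Prop :=
  exists wr wc wd : word,
    [/\ rat_code (rate m) wr, rat_code (cost_c m) wc, rat_code (cost_d m) wd
      & w = Semicolon :: wr ++ Comma :: wc ++ Comma :: wd].

Definition system_code (S : system) (w : word) : Prop :=
  exists (wmin wmax w0 : word) (f : mode S -> word),
    [/\ rat_code (vmin S) wmin, rat_code (vmax S) wmax, rat_code (v0 S) w0,
        forall m, mode_code m (f m)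
      & w = wmin ++ Comma :: wmax ++ Comma :: w0
            ++ flatten [seq f m | m <- enum (mode S)]].

(* In schedules, a mode is named by its rank in the list of the modes. *)
Definition action_code (S : system) (x : mode S * rat) (w : word) : Prop :=
  exists wm wt : word,
    [/\ nat_code (enum_rank x.1) wm, rat_code x.2 wt
      & w = Semicolon :: wm ++ Comma :: wt].

Fixpoint actions_code (S : system) (p : seq (mode S * rat)) (w : word) : Prop :=
  if p is x :: p' then
    exists w1 w2 : word,
      [/\ action_code x w1, actions_code p' w2 & w = w1 ++ w2]
  else w = [::].

Definition description_code (S : system) (D : description S) (w : word) :
    Prop :=
  match D with
  | Lasso p x c =>
      exists wp wc : word,
        [/\ actions_code p wp, actions_code (x :: c) wc & w = wp ++ Bar :: wc]
  | Final p m =>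
      exists wp wm : word,
        [/\ actions_code p wp, nat_code (enum_rank m) wm
          & w = wp ++ Semicolon :: wm ++ [:: Comma; Infty]]
  end.

(* The empty word, which codes no description, reports that the system has no
   safe schedule with infinite time horizon. *)
Definition optimal_schedule_code (R : realType) (S : system) (w : word) : Prop :=
  (exists D : description S,
     description_code D w /\ optimal (described R D)) \/
  (w = [::] /\ ~ exists s : schedule R S, safe_schedule s).

(* Main.v *)
Require Import Defs.
From mathcomp Require Import all_boot all_order all_algebra.
From mathcomp Require Import all_classical all_reals all_analysis.
From mathcomp Require Import zify ring lra.

Set Implicit Arguments.
Unset Strict Implicit.
Unset Printing Implicit Defensive.

(* A register program (increments, loops that count a register down, tests of an
   input cell) whose registers stay polynomially bounded runs in logarithmic
   space, each register being a binary counter on its own tape.  Such programs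
   are closed under polynomially bounded recursion, hence compute sums, searches
   and, with signed carries, the bits of any integer given by polynomially
   bounded coefficients at the powers of 2.  Sums, differences and products of
   numbers read from the input are of this form, so fractions built from the
   input by a fixed number of operations can be compared and printed.

   An optimal schedule stays for ever in a mode with rate 0, or alternates
   between an ascending and a descending mode over the whole range of the
   variable.  If l is the least cost among these, an action of duration t in mode
   m satisfies pi_d(m) + pi_c(m) t - l t >= s A(m) t for some slope s independent
   of the action; as the variable is bounded, the cost of any safe schedule up to
   time T is at least l T - C.  Hence it suffices to search all pairs of modes. *)

(** * Register programs and their compilation *)

(** Cross products of input numbers have polynomially many bits and fit in no register. They are
    therefore never stored: an integer is given by a function that yields its coefficients on
    demand, and every bit is recomputed whenever it is needed. Sums and convolutions of such
    functions keep the coefficients polynomially bounded, so no carry is resolved before a sign is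
    tested or a numeral printed. Division is avoided by keeping fractions as unreduced pairs, which
    the output format allows. All programs compute total functions of the input word, because
    halting and the space bound are required on ill-formed words too; well-formedness enters only
    when the output is interpreted. In the lower bound, [s] plays the part of a dual variable for
    the constraint that the variable stays in a bounded interval: the terms [s A(m) t] telescope
    along a run. Its existence reduces to one inequality for each pair of an ascending and a
    descending mode, which says exactly that the cycle cost of the pair is at least [l]. *)

Section Commands.
Variables Sin Sout : finType.

Inductive cmd :=
| Skip
| Inc of nat
| Seq of cmd & cmd
| Loop of nat & cmd
| IfCell of pred (icell Sin) & cmd & cmd
| Head of move
| Emit of Sout.

Record store := Store { regs : nat -> nat; hpos : nat; out : seq Sout }.

Definition upd (rho : nat -> nat) (r v : nat) : nat -> nat :=
  fun q => if q == r then v else rho q.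

(* [Loop r c] is "while [r] is positive, decrement [r] and perform [c]"; [B]
   bounds the values to which registers are incremented. *)
Inductive exec (w : seq Sin) (B : nat) : cmd -> store -> store -> Prop :=
| ExSkip s : exec w B Skip s s
| ExInc rho h o r : rho r < B ->
    exec w B (Inc r) (Store rho h o) (Store (upd rho r (rho r).+1) h o)
| ExSeq c d s1 s2 s3 : exec w B c s1 s2 -> exec w B d s2 s3 ->
    exec w B (Seq c d) s1 s3
| ExLoop0 rho h o r c : rho r = 0 ->
    exec w B (Loop r c) (Store rho h o) (Store rho h o)
| ExLoopS rho h o r c n s2 s3 : rho r = n.+1 ->
    exec w B c (Store (upd rho r n) h o) s2 -> exec w B (Loop r c) s2 s3 ->
    exec w B (Loop r c) (Store rho h o) s3
| ExIf (p : pred (icell Sin)) c d rho h o s :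
    exec w B (if p (icell_at w h) then c else d) (Store rho h o) s ->
    exec w B (IfCell p c d) (Store rho h o) s
| ExHead rho h o m : exec w B (Head m) (Store rho h o)
    (Store rho (minn (Defs.shift m h) (size w).+1) o)
| ExEmit rho h o a :
    exec w B (Emit a) (Store rho h o) (Store rho h (rcons o a)).

Fixpoint max_reg (c : cmd) : nat :=
  match c with
  | Skip | Head _ | Emit _ => 0
  | Inc r => r
  | Seq c d | IfCell _ c d => maxn (max_reg c) (max_reg d)
  | Loop r c => maxn r (max_reg c)
  end.

Section Compilation.
Variable k : nat.

(* A register is kept on its own tape, least significant bit first; a cell
   holds a bit together with a flag that marks cell 0. *)
Definition cell : finType := option (bool * bool).
Definition reads : Type := {ffun 'I_k.+1 -> cell}.
Definition act : Type := (move * {ffun 'I_k.+1 -> cell * move} * option Sout)%type.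

Definition idle (s : reads) : {ffun 'I_k.+1 -> cell * move} :=
  [ffun i => (s i, MoveStay)].

Definition act1 (s : reads) (r : 'I_k.+1) (y : cell) (d : move) : act :=
  (MoveStay, [ffun i => if i == r then (y, d) else (s i, MoveStay)], None).

(* [Some b] propagates a carry, [b] telling whether the head is on cell 0;
   [None] brings the head back to cell 0. *)
Definition inc_delta (r : 'I_k.+1) (q : option bool) (s : reads) :
    (option bool + unit) * act :=
  match q, s r with
  | Some b, None => (inl None, act1 s r (Some (b, true)) MoveStay)
  | Some _, Some (mk, false) => (inl None, act1 s r (Some (mk, true)) MoveStay)
  | Some _, Some (mk, true) =>
      (inl (Some false), act1 s r (Some (mk, false)) MoveRight)
  | None, Some (true, x) => (inr tt, act1 s r (Some (true, x)) MoveStay)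
  | None, y => (inl None, act1 s r y MoveLeft)
  end.

(* [inl b] propagates a borrow; [inr true] brings the head back after a
   decrement; [inr false] brings it back from the end of a null numeral, whose
   bits have been flipped and are restored on the way. *)
Definition dec_delta (r : 'I_k.+1) (q : bool + bool) (s : reads) :
    ((bool + bool) + bool) * act :=
  match q, s r with
  | inl _, Some (mk, false) =>
      (inl (inl false), act1 s r (Some (mk, true)) MoveRight)
  | inl _, Some (mk, true) =>
      (inl (inr true), act1 s r (Some (mk, false)) MoveStay)
  | inl true, None => (inr false, act1 s r None MoveStay)
  | inl false, None => (inl (inr false), act1 s r None MoveLeft)
  | inr true, Some (true, x) => (inr true, act1 s r (Some (true, x)) MoveStay)
  | inr true, y => (inl (inr true), act1 s r y MoveLeft)
  | inr false, Some (true, _) =>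
      (inr false, act1 s r (Some (true, false)) MoveStay)
  | inr false, y =>
      (inl (inr false), act1 s r (omap (fun _ => (false, false)) y) MoveLeft)
  end.

Fixpoint cstate (c : cmd) : finType :=
  match c with
  | Skip | Head _ | Emit _ => unit
  | Inc _ => option bool
  | Seq c d => (cstate c + cstate d)%type
  | Loop _ c => ((bool + bool) + cstate c)%type
  | IfCell _ c d => option (cstate c + cstate d)%type
  end.

Fixpoint cstart (c : cmd) : cstate c :=
  match c return cstate c with
  | Skip | Head _ | Emit _ => tt
  | Inc _ => Some true
  | Seq c d => inl (cstart c)
  | Loop _ c => inl (inl true)
  | IfCell _ c d => None
  end.

(** A component signals its exit by [inr], and the enclosing command redirects this exit, within the
    same step, to the start of whatever comes next. Only [IfCell] needs an extra state, [None], in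
    which the input cell is tested. *)
Fixpoint cdelta (c : cmd) : cstate c -> icell Sin -> reads ->
    (cstate c + unit) * act :=
  match c return cstate c -> icell Sin -> reads -> (cstate c + unit) * act with
  | Skip => fun _ _ s => (inr tt, (MoveStay, idle s, None))
  | Head m => fun _ _ s => (inr tt, (m, idle s, None))
  | Emit a => fun _ _ s => (inr tt, (MoveStay, idle s, Some a))
  | Inc r => fun q _ s => inc_delta (inord r) q s
  | Seq c d => fun q x s =>
      match q with
      | inl q => let: (e, a) := cdelta q x s in
          (inl (match e with inl q' => inl q' | inr _ => inr (cstart d) end), a)
      | inr q => let: (e, a) := cdelta q x s in
          (match e with inl q' => inl (inr q') | inr _ => inr tt end, a)
      end
  | Loop r c => fun q x s =>
      match q with
      | inl q => let: (e, a) := dec_delta (inord r) q s in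
          (match e with
           | inl q' => inl (inl q')
           | inr true => inl (inr (cstart c))
           | inr false => inr tt
           end, a)
      | inr q => let: (e, a) := cdelta q x s in
          (inl (match e with inl q' => inr q' | inr _ => inl (inl true) end), a)
      end
  | IfCell p c d => fun q x s =>
      match q with
      | None => (inl (Some (if p x then inl (cstart c) else inr (cstart d))),
                 (MoveStay, idle s, None))
      | Some (inl q) => let: (e, a) := cdelta q x s in
          (match e with inl q' => inl (Some (inl q')) | inr _ => inr tt end, a)
      | Some (inr q) => let: (e, a) := cdelta q x s in
          (match e with inl q' => inl (Some (inr q')) | inr _ => inr tt end, a)
      end
  end.

Record mem := Mem {
  mi : nat; mt : 'I_k.+1 -> nat -> cell; mp : 'I_k.+1 -> nat; mo : seq Sout }.

Variables (w : seq Sin) (W : nat).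

Definition apply_act (a : act) (m : mem) : mem :=
  let: (d, f, o) := a in
  Mem (minn (Defs.shift d (mi m)) (size w).+1)
      (fun i p => if p == mp m i then (f i).1 else mt m i p)
      (fun i => Defs.shift (f i).2 (mp m i))
      (mo m ++ seq_of_opt o).

Definition read (m : mem) : reads := [ffun i => mt m i (mp m i)].
Definition fits (m : mem) : Prop := forall i, mp m i <= W.

(** The bound on the work heads is demanded before every step, so one derivation proves termination
    and the space bound together. *)
Inductive reach (Q X : Type)
    (D : Q -> icell Sin -> reads -> (Q + X) * act) :
    Q -> mem -> X -> mem -> Prop :=
| ReachExit q m x a : fits m ->
    D q (icell_at w (mi m)) (read m) = (inr x, a) ->
    reach D q m x (apply_act a m)
| ReachStep q m q' a x m' : fits m ->
    D q (icell_at w (mi m)) (read m) = (inl q', a) ->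
    reach D q' (apply_act a m) x m' -> reach D q m x m'.

Definition setr (m : mem) (r : 'I_k.+1) (t : nat -> cell) (p : nat) : mem :=
  Mem (mi m) (fun i => if i == r then t else mt m i)
      (fun i => if i == r then p else mp m i) (mo m).

Lemma apply_act1 m r t p y d : mi m <= (size w).+1 ->
  apply_act (act1 (read (setr m r t p)) r y d) (setr m r t p) =
  setr m r (fun q => if q == p then y else t q) (Defs.shift d p).
Proof.
move=> hm; rewrite /apply_act /= cats0 /setr /=; congr Mem.
- exact/minn_idPl.
- apply/funext => i; apply/funext => q; rewrite !ffunE.
  by case e: (i == r) => //=; rewrite e; case: eqP => // ->.
- by apply/funext => i; rewrite ffunE; case: (i == r).
Qed.

Lemma apply_idle m d o : mi m <= (size w).+1 ->
  apply_act (d, idle (read m), o) m =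
  Mem (minn (Defs.shift d (mi m)) (size w).+1) (mt m) (mp m) (mo m ++ seq_of_opt o).
Proof.
move=> hm; rewrite /apply_act; congr Mem.
- apply/funext => i; apply/funext => q; rewrite !ffunE /=.
  by case: eqP => // ->.
- by apply/funext => i; rewrite ffunE.
Qed.

Lemma read_setr m r t p : read (setr m r t p) r = t p.
Proof. by rewrite ffunE /= eqxx. Qed.

(** Cells past the numeral are blank, so an untouched tape is the empty numeral and every register
    starts at 0. Zeros at the high end are allowed; decrements never shorten a numeral. *)
Definition enc (s : seq bool) (p : nat) : cell :=
  if p < size s then Some (p == 0, nth false s p) else None.

Lemma enc_mid s1 x s2 : enc (s1 ++ x :: s2) (size s1) = Some (size s1 == 0, x).
Proof.
by rewrite /enc size_cat /= -[X in X < _]addn0 ltn_add2l /= nth_cat ltnn subnn.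
Qed.

Lemma enc_end s : enc s (size s) = None.
Proof. by rewrite /enc ltnn. Qed.

Lemma enc_set s1 x y s2 :
  (fun q => if q == size s1 then Some (size s1 == 0, y)
            else enc (s1 ++ x :: s2) q) = enc (s1 ++ y :: s2).
Proof.
apply/funext => q; case: eqP => [->|/eqP hq]; first by rewrite enc_mid.
rewrite /enc !size_cat /=; case: ifP => // _; congr (Some (_, _)).
rewrite !nth_cat; case: ltnP => // hs.
have : 0 < q - size s1 by lia.
by case: (q - size s1).
Qed.

Lemma enc_app s y :
  (fun q => if q == size s then Some (size s == 0, y) else enc s q) =
  enc (rcons s y).
Proof.
apply/funext => q; rewrite /enc size_rcons nth_rcons.
by case: (ltngtP q (size s)) => [h|h|->]; rewrite ?ltnS ?leqnn // ?(ltnW h) // leqNgt h.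
Qed.

Lemma enc_id s p : (fun q => if q == p then enc s p else enc s q) = enc s.
Proof. by apply/funext => q; case: eqP => // ->. Qed.

(** * Increment and decrement of binary counters *)

Fixpoint bits_val (s : seq bool) : nat :=
  if s is b :: s' then b + (bits_val s').*2 else 0.

Fixpoint bits_inc (s : seq bool) : seq bool :=
  match s with
  | [::] => [:: true]
  | false :: s' => true :: s'
  | true :: s' => false :: bits_inc s'
  end.

Fixpoint bits_dec (s : seq bool) : seq bool :=
  match s with
  | [::] => [::]
  | false :: s' => true :: bits_dec s'
  | true :: s' => false :: s'
  end.

Lemma bits_incE s : bits_val (bits_inc s) = (bits_val s).+1.
Proof. by elim: s => //= -[] s //= ->; rewrite doubleS. Qed.

Lemma bits_decE s n : bits_val s = n.+1 -> bits_val (bits_dec s) = n.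
Proof.
elim: s n => //= -[] s /= IHs n; first by rewrite add1n add0n => -[].
case e: (bits_val s) => [|v] //; rewrite doubleS => -[<-].
by rewrite (IHs v e).
Qed.

Lemma size_bits_dec s : size (bits_dec s) = size s.
Proof. by elim: s => //= -[] s //= ->. Qed.

(** A numeral grows only when all its bits are 1, and then its successor is [2 ^ size s]; being
    below [2 ^ W], this forces [size s < W]. *)
Lemma size_bits_inc s : size s <= W ->
  (bits_val s).+1 < 2 ^ W -> size (bits_inc s) <= W.
Proof.
have H t : size (bits_inc t) <= size t \/
           size (bits_inc t) = (size t).+1 /\ (bits_val t).+1 = 2 ^ size t.
  elim: t => [|[] t IHt] /=; [by right|case: IHt => [h|[h1 h2]]|by left].
  - by left.
  - by right; rewrite h1 expnS -h2; split => //; lia.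
move=> hs hb; case: (H s) => [|[-> e]]; first by lia.
by rewrite e in hb; rewrite ltn_exp2l in hb.
Qed.

Lemma bits_val0 s : bits_val s = 0 -> s = nseq (size s) false.
Proof.
by elim: s => //= -[] s IHs //= h; congr cons; apply: IHs; lia.
Qed.

Definition home (m : mem) : Prop :=
  (mi m <= (size w).+1) /\ forall i, mp m i = 0.

Lemma fits_setr m r t p : home m -> p <= W -> fits (setr m r t p).
Proof. by move=> [_ hm] hp i /=; case: (i == r); rewrite ?hm. Qed.

Definition inc_machine r q (_ : icell Sin) s := inc_delta r q s.
Definition dec_machine r q (_ : icell Sin) s := dec_delta r q s.

Lemma reach_step1 (Q X : Type) (D : Q -> icell Sin -> reads -> (Q + X) * act)
    m r t p q q' y d x m' : home m -> p <= W ->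
  D q (icell_at w (mi m)) (read (setr m r t p)) =
    (inl q', act1 (read (setr m r t p)) r y d) ->
  reach D q' (setr m r (fun q => if q == p then y else t q) (Defs.shift d p)) x m' ->
  reach D q (setr m r t p) x m'.
Proof.
move=> hm hp hD hr; apply: (ReachStep (fits_setr _ _ hm hp) hD).
by rewrite apply_act1 //; case: hm.
Qed.

Lemma reach_exit1 (Q X : Type) (D : Q -> icell Sin -> reads -> (Q + X) * act)
    m r t p q y d x : home m -> p <= W ->
  D q (icell_at w (mi m)) (read (setr m r t p)) =
    (inr x, act1 (read (setr m r t p)) r y d) ->
  reach D q (setr m r t p) x
    (setr m r (fun q => if q == p then y else t q) (Defs.shift d p)).
Proof.
move=> hm hp hD; rewrite -apply_act1; last by case: hm.
exact: (ReachExit (fits_setr _ _ hm hp) hD).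
Qed.

Lemma inc_back m r s p : home m -> p < size s -> size s <= W ->
  reach (inc_machine r) None (setr m r (enc s) p) tt (setr m r (enc s) 0).
Proof.
move=> hm hp hs; elim: p hp => [|p IHp] hp.
- rewrite -[in X in reach _ _ _ _ X](enc_id s 0) -/(Defs.shift MoveStay 0).
  apply: reach_exit1 => //; rewrite /inc_machine /inc_delta read_setr.
  by rewrite /enc hp.
- apply: (@reach_step1 _ _ _ _ _ _ _ _ None (enc s p.+1) MoveLeft) => //.
  + by lia.
  + by rewrite /inc_machine /inc_delta read_setr /enc hp.
  + by rewrite enc_id; apply: IHp; lia.
Qed.

(** [s1] is what the carry has already passed and [s2] what lies ahead. The boolean in the state is
    needed on an empty tape, where the first written cell must receive the mark of cell 0. *)
Lemma inc_carry m r s1 s2 : home m ->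
  size (bits_inc s2) + size s1 <= W ->
  reach (inc_machine r) (Some (size s1 == 0))
    (setr m r (enc (s1 ++ s2)) (size s1)) tt
    (setr m r (enc (s1 ++ bits_inc s2)) 0).
Proof.
move=> hm; elim: s2 s1 => [|[] s2 IHs] s1 /= hs.
- apply: (@reach_step1 _ _ _ _ _ _ _ _ None (Some (size s1 == 0, true)) MoveStay) => //.
  + by lia.
  + by rewrite /inc_machine /inc_delta read_setr cats0 enc_end.
  + rewrite cats0 enc_app cats1; apply: inc_back => //=; rewrite ?size_rcons; lia.
- apply: (@reach_step1 _ _ _ _ _ _ _ _ (Some false) (Some (size s1 == 0, false))
  MoveRight) => //.
  + by lia.
  + by rewrite /inc_machine /inc_delta read_setr enc_mid.
  + rewrite enc_set -!cat_rcons /=.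
    have := IHs (rcons s1 false); rewrite size_rcons /=; apply.
    by lia.
- apply: (@reach_step1 _ _ _ _ _ _ _ _ None (Some (size s1 == 0, true)) MoveStay) => //.
  + by lia.
  + by rewrite /inc_machine /inc_delta read_setr enc_mid.
  + by rewrite enc_set; apply: inc_back => //; rewrite size_cat /=; lia.
Qed.

Lemma dec_back m r s p : home m -> p < size s -> size s <= W ->
  reach (dec_machine r) (inr true) (setr m r (enc s) p) true
    (setr m r (enc s) 0).
Proof.
move=> hm hp hs; elim: p hp => [|p IHp] hp.
- rewrite -[in X in reach _ _ _ _ X](enc_id s 0) -/(Defs.shift MoveStay 0).
  apply: reach_exit1 => //; rewrite /dec_machine /dec_delta read_setr.
  by rewrite /enc hp.
- apply: (@reach_step1 _ _ _ _ _ _ _ _ (inr true) (enc s p.+1) MoveLeft) => //.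
  + by lia.
  + by rewrite /dec_machine /dec_delta read_setr /enc hp.
  + by rewrite enc_id; apply: IHp; lia.
Qed.

(** The bits of [s1] may be anything: the head overwrites them with 0 on its way back. The block
    [nseq n false] is the part already restored. *)
Lemma dec_undo m r s1 n : home m -> size s1 + n <= W -> 0 < size s1 ->
  reach (dec_machine r) (inr false)
    (setr m r (enc (s1 ++ nseq n false)) (size s1).-1) false
    (setr m r (enc (nseq (size s1 + n) false)) 0).
Proof.
move=> hm; elim/last_ind: s1 n => // s1 b IHs n hn _.
rewrite size_rcons /= cat_rcons in hn *.
case: (posnP (size s1)) => h0.
- move/size0nil: h0 => e0; subst s1.
  have := @enc_set [::] b false (nseq n false); rewrite /= => <-.
  rewrite -/(Defs.shift MoveStay 0).
  by apply: reach_exit1 => //; rewrite /dec_machine /dec_delta read_setr.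
- apply: (@reach_step1 _ _ _ _ _ _ _ _ (inr false) (Some (size s1 == 0, false))
  MoveLeft) => //.
  + by lia.
  + rewrite /dec_machine /dec_delta read_setr enc_mid.
    by case: (size s1) h0.
  + rewrite enc_set; have := IHs n.+1; rewrite addnS /=; exact.
Qed.

Lemma dec_borrow m r s1 s2 : home m -> size (s1 ++ s2) <= W ->
  0 < bits_val s2 ->
  reach (dec_machine r) (inl (size s1 == 0))
    (setr m r (enc (s1 ++ s2)) (size s1)) true
    (setr m r (enc (s1 ++ bits_dec s2)) 0).
Proof.
move=> hm; elim: s2 s1 => // -[] s2 IHs s1; rewrite size_cat => hs hv.
- apply: (@reach_step1 _ _ _ _ _ _ _ _ (inr true) (Some (size s1 == 0, false))
  MoveStay) => //.
  + by lia.
  + by rewrite /dec_machine /dec_delta read_setr enc_mid; case: (size s1 == 0).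
  + by rewrite enc_set; apply: dec_back => //=; rewrite size_cat /= in hs *; lia.
- apply: (@reach_step1 _ _ _ _ _ _ _ _ (inl false) (Some (size s1 == 0, true))
  MoveRight) => //.
  + by lia.
  + by rewrite /dec_machine /dec_delta read_setr enc_mid; case: (size s1 == 0).
  + rewrite enc_set /= -!cat_rcons.
    have := IHs (rcons s1 true); rewrite size_cat size_rcons /=; apply.
      by rewrite /= in hs; lia.
    by rewrite /= in hv; lia.
Qed.

(** The test for zero is a decrement whose borrow runs off the end of the numeral. An empty numeral
    has no marked cell to return to, so the state [inl true] exits at once on a blank. *)
Lemma dec_zero m r s1 n : home m -> size s1 + n <= W ->
  reach (dec_machine r) (inl (size s1 == 0))
    (setr m r (enc (s1 ++ nseq n false)) (size s1)) false
    (setr m r (enc (nseq (size s1 + n) false)) 0).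
Proof.
move=> hm; elim: n s1 => [|n IHn] s1 /= hn.
- rewrite cats0 addn0; case: (posnP (size s1)) => h0.
  + move/size0nil: h0 => -> /=.
    rewrite -[in X in reach _ _ _ _ X](enc_id [::] 0) -/(Defs.shift MoveStay 0).
    by apply: reach_exit1 => //; rewrite /dec_machine /dec_delta read_setr.
  + apply: (@reach_step1 _ _ _ _ _ _ _ _ (inr false) (enc s1 (size s1)) MoveLeft) => //.
    * by lia.
    * rewrite /dec_machine /dec_delta read_setr enc_end.
      by case: (size s1) h0.
    * rewrite enc_id; have := @dec_undo m r s1 0 hm; rewrite cats0 addn0.
      by apply => //; lia.
- apply: (@reach_step1 _ _ _ _ _ _ _ _ (inl false) (Some (size s1 == 0, true))
  MoveRight) => //.
  + by lia.
  + by rewrite /dec_machine /dec_delta read_setr enc_mid; case: (size s1 == 0).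
  + rewrite enc_set /= -!cat_rcons.
    have := IHn (rcons s1 true); rewrite size_rcons /= addnS; apply.
    by lia.
Qed.

(** * Lifting runs of a component to the enclosing command *)

Section Embedding.
Variables (Q Q' X X' : Type) (D : Q -> icell Sin -> reads -> (Q + X) * act)
  (D' : Q' -> icell Sin -> reads -> (Q' + X') * act)
  (f : Q -> Q') (g : X -> Q' + X').
Hypothesis embed : forall q a s, D' (f q) a s =
  let: (e, b) := D q a s in
  (match e with inl q' => inl (f q') | inr x => g x end, b).

(** [f] embeds the states of the component and [g] tells where its exits lead. Here the exit leads
    to a state of the larger machine; in [reach_last] it is an exit of the larger machine as
    well. *)
Lemma reach_trans q m x m1 q1 y m2 :
  reach D q m x m1 -> g x = inl q1 -> reach D' q1 m1 y m2 ->
  reach D' (f q) m y m2.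
Proof.
elim=> {q m x m1} [q m x a hf hq|q m q' a x m' hf hq _ IH] hx hr.
- by apply: (ReachStep hf _ hr); rewrite embed hq hx.
- by apply: (ReachStep hf _ (IH hx hr)); rewrite embed hq.
Qed.

Lemma reach_last q m x m1 y :
  reach D q m x m1 -> g x = inr y -> reach D' (f q) m y m1.
Proof.
elim=> {q m x m1} [q m x a hf hq|q m q' a x m' hf hq _ IH] hx.
- by apply: ReachExit => //; rewrite embed hq hx.
- by apply: (ReachStep hf _ (IH hx)); rewrite embed hq.
Qed.
End Embedding.

Definition represents (m : mem) (s : store) : Prop :=
  [/\ home m, mi m = hpos s, mo m = out s
    & forall i : 'I_k.+1, exists b, [/\ bits_val b = regs s i, size b <= W
                                      & mt m i = enc b]].


Lemma setr_id m r b : mt m r = enc b -> mp m r = 0 -> setr m r (enc b) 0 = m.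
Proof.
case: m => i t p o /= ht hp; rewrite /setr /=.
by congr Mem; apply/funext => j; case: eqP => // ->.
Qed.

Lemma represents_setr m s r b v : r <= k -> represents m s ->
  bits_val b = v -> size b <= W ->
  represents (setr m (inord r) (enc b) 0) (Store (upd (regs s) r v) (hpos s) (out s)).
Proof.
move=> hr [[h1 h2] h3 h4 h5] hv hb; split=> //=.
  by split=> //= i; case: ifP.
move=> i; rewrite /upd; case: (i =P inord r) => [->|hi].
  by exists b; rewrite inordK // eqxx.
have -> : (i == r :> nat) = false.
  by apply/eqP => e; apply: hi; apply/val_inj; rewrite /= inordK.
exact: h5.
Qed.

(** Induction on the execution. Increments keep values at most [B < 2 ^ W], so by [size_bits_inc] no
    numeral outgrows [W] cells. A loop uses the two exits of the decrement: [true] enters the body,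
    [false] leaves. *)
Lemma compile_correct B c s s' m : B < 2 ^ W -> exec w B c s s' ->
  max_reg c <= k -> represents m s ->
  exists2 m', reach (@cdelta c) (cstart c) m tt m' & represents m' s'.
Proof.
move=> hB hc; elim: hc m => {c s s'} /=.
- move=> s m _ hm; exists (apply_act (MoveStay, idle (read m), None) m).
    apply: ReachExit => // i; by case: hm => -[_ ->].
  case: hm => -[h1 h2] h3 h4 h5; rewrite apply_idle //= cats0 (minn_idPl h1).
  by split.
- move=> rho h o r hr m hk hm.
  have [b [hv hb hmt]] := (let: And4 _ _ _ h := hm in h) (inord r).
  rewrite /= inordK // in hv.
  have hh : home m by case: hm.
  have hs : size (bits_inc b) <= W.
    by apply: size_bits_inc => //; rewrite hv; lia.
  exists (setr m (inord r) (enc (bits_inc b)) 0).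
    have := @inc_carry m (inord r) [::] b hh; rewrite /= addn0 setr_id //.
      exact.
    by case: hh.
  by apply: (represents_setr hk hm) => //; rewrite bits_incE hv.
- move=> c d s1 s2 s3 _ IHc _ IHd m; rewrite geq_max => /andP[kc kd] hm.
  have [m1 r1 hm1] := IHc m kc hm.
  have [m2 r2 hm2] := IHd m1 kd hm1.
  exists m2 => //.
  apply: (@reach_trans _ _ _ _ (@cdelta c) (@cdelta (Seq c d)) inl
    (fun _ => inl (inr (cstart d))) _ _ _ _ _ _ _ _ r1) => //.
  - by move=> q a t /=; case: cdelta => -[].
  apply: (@reach_last _ _ _ _ (@cdelta d) (@cdelta (Seq c d)) inr inr
    _ _ _ _ _ _ r2) => //.
  by move=> q a t /=; case: cdelta => -[q'|[]].
- move=> rho h o r c hr m; rewrite geq_max => /andP[kr kc] hm.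
  have [b [hv hb hmt]] := (let: And4 _ _ _ h := hm in h) (inord r).
  rewrite /= inordK // hr in hv.
  have hh : home m by case: hm.
  exists m => //.
  have hd := @dec_zero m (inord r) [::] (size b) hh hb.
  rewrite /= -bits_val0 // setr_id // in hd; last by case: hh.
  apply: (@reach_last _ _ _ _ (dec_machine (inord r)) (@cdelta (Loop r c))
    inl (fun e => if e then inl (inr (cstart c)) else inr tt)
    _ _ _ _ _ _ hd) => //.
- move=> rho h o r c n s2 s3 hr _ IHc _ IHl m hk hm.
  have /andP[kr kc] : (r <= k) && (max_reg c <= k) by rewrite -geq_max.
  have [b [hv hb hmt]] := (let: And4 _ _ _ h := hm in h) (inord r).
  rewrite /= inordK // hr in hv.
  have hh : home m by case: hm.
  have hm1 : represents (setr m (inord r) (enc (bits_dec b)) 0)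
                        (Store (upd rho r n) h o).
    by apply: (represents_setr kr hm); rewrite ?size_bits_dec //; apply: bits_decE.
  have [m2 r2 hm2] := IHc _ kc hm1.
  have [m3 r3 hm3] := IHl _ hk hm2.
  exists m3 => //.
  have hb0 : 0 < bits_val b by rewrite hv.
  have hd := @dec_borrow m (inord r) [::] b hh hb hb0.
  rewrite /= setr_id // in hd; last by case: hh.
  apply: (@reach_trans _ _ _ _ (dec_machine (inord r)) (@cdelta (Loop r c))
    inl (fun e => if e then inl (inr (cstart c)) else inr tt)
    _ _ _ _ _ _ _ _ hd) => //.
  apply: (@reach_trans _ _ _ _ (@cdelta c) (@cdelta (Loop r c)) inr
    (fun _ => inl (inl (inl true))) _ _ _ _ _ _ _ _ r2) => //.
  by move=> q a t /=; case: cdelta => -[].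
- move=> p c d rho h o s _ IH m; rewrite geq_max => /andP[kc kd] hm.
  have hh : home m by case: hm.
  set m0 := apply_act (MoveStay, idle (read m), None) m.
  have hm0 : represents m0 (Store rho h o).
    case: hm hh => -[h1 h2] h3 h4 h5 _; rewrite /m0 apply_idle //= cats0.
    by rewrite (minn_idPl h1); split.
  have ep : icell_at w (mi m) = icell_at w h by case: hm => _ ->.
  have [|m1 r1 hm1] := IH m0 _ hm0; first by case: (p _).
  exists m1 => //; apply: (ReachStep _ _ (a := (MoveStay, idle (read m), None))).
  + by move=> i; case: hh => _ ->.
  + by rewrite /= ep.
  case: (p _) r1 => r1.
  + apply: (@reach_last _ _ _ _ (@cdelta c) (@cdelta (IfCell p c d))
       (fun q => Some (inl q)) inr _ _ _ _ _ _ r1) => //.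
    by move=> q a t /=; case: cdelta => -[q'|[]].
  + apply: (@reach_last _ _ _ _ (@cdelta d) (@cdelta (IfCell p c d))
       (fun q => Some (inr q)) inr _ _ _ _ _ _ r1) => //.
    by move=> q a t /=; case: cdelta => -[q'|[]].
- move=> rho h o d m _ hm; exists (apply_act (d, idle (read m), None) m).
    apply: ReachExit => // i; by case: hm => -[_ ->].
  case: hm => -[h1 h2] h3 h4 h5; rewrite apply_idle //= cats0.
  by split=> //=; [split=> //=; apply: geq_minr|rewrite h3].
- move=> rho h o a m _ hm; exists (apply_act (MoveStay, idle (read m), Some a) m).
    apply: ReachExit => // i; by case: hm => -[_ ->].
  case: hm => -[h1 h2] h3 h4 h5; rewrite apply_idle //= (minn_idPl h1).
  by split=> //=; rewrite h4 -cats1.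
Qed.

End Compilation.

(** * From programs to transducers *)

Section Machine.
Variable c : cmd.
Let k := max_reg c.

Definition machine : transducer Sin Sout :=
  @Transducer Sin Sout (option (cstate c)) k.+1 cell None (Some (cstart c))
    (fun q => ~~ isSome q)
    (fun q x s =>
       if q is Some q then
         let: (e, (d, f, o)) := @cdelta k c q x s in
         (match e with inl q' => Some q' | inr _ => None end, d, f, o)
       else (None, MoveStay, idle s, None)).

Variable w : seq Sin.

Definition configuration q (m : mem k) : config machine :=
  @Config Sin Sout machine q (mi m) (mt m) (mp m) (mo m).

Lemma reach_run W q m m' : reach w W (@cdelta k c) q m tt m' ->
  exists n, iter n (Defs.step w) (configuration (Some q) m) =
              configuration None m' /\
    forall j, j < n -> forall i,
      wpos (iter j (Defs.step w) (configuration (Some q) m)) i <= W.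
Proof.
move e: tt => x hr; elim: hr e => {q m m'} /=.
- move=> q m [] a hf hq _; exists 1; split=> [|[_|j]];
  [|exact: hf|by rewrite ltnS ltn0].
  rewrite /= /Defs.step /=; case: a hq => [[d f] o].
  by rewrite /read => ->.
- move=> q m q' a x' m' hf hq _ IH e.
  have [n [hn hs]] := IH e.
  have hstep : Defs.step w (configuration (Some q) m) =
               configuration (Some q') (apply_act w a m).
    rewrite /Defs.step /=; case: a hq {IH hn hs} => [[d f] o].
    by rewrite /read => ->.
  exists n.+1; rewrite iterSr hstep; split=> // -[|j] hj; first exact: hf.
  by rewrite iterSr hstep; apply: hs.
Qed.

End Machine.

Lemma exec_logspace (c : cmd) (C : nat) (f : seq Sin -> seq Sout) :
  (forall w, exists B rho,
     B < 2 ^ (C * (trunc_log 2 (size w)).+1) /\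
     exec w B c (Store (fun=> 0) 0 [::]) (Store rho 0 (f w))) ->
  exists T : transducer Sin Sout, logspace T /\ forall w, outputs T w (f w).
Proof.
move=> hc; exists (machine c).
suff H w : exists n, [/\ halting (Defs.cstate (Defs.run (machine c) w n)),
    output (Defs.run (machine c) w n) = f w
    & forall j i, wpos (Defs.run (machine c) w j) i <=
                  C * (trunc_log 2 (size w)).+1].
  split=> [|w]; last by have [n [h1 h2 _]] := H w; exists n.
  (* One more than [C]: a head may reach the blank in cell [W] itself, while the space bound is
     strict. *)
  exists C.+1 => w; have [n [h1 _ h2]] := H w; split; first by exists n.
  move=> j i; rewrite mulSn; apply: (leq_ltn_trans (h2 j i)).
  by rewrite -[X in X < _]add0n ltn_add2r.
have [B [rho [hB he]]] := hc w.
set W := C * _ in hB *.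
set m0 := @Mem (max_reg c) 0 (fun=> fun=> None) (fun=> 0) [::].
have hm0 : represents w W m0 (Store (fun=> 0) 0 [::]).
  by split=> // i; exists [::].
have [m1 r1 hm1] := compile_correct hB he (leqnn _) hm0.
have [n [hn hs]] := reach_run r1.
have e0 j : Defs.run (machine c) w j =
            iter j (Defs.step w) (configuration (Some (cstart c)) m0) by [].
exists n; split.
- by rewrite e0 hn.
- by rewrite e0 hn; case: hm1 => _ _ /= ->.
- move=> j i; rewrite e0; case: (ltnP j n) => hj; first exact: hs.
  rewrite -(subnK hj) iterD hn; set cf := configuration _ _.
  have -> : iter (j - n) (Defs.step w) cf = cf.
    by elim: (j - n) => // l /= ->.
  by case: hm1 => -[_ /= ->].
Qed.

End Commands.

(** * Functions computed by register programs *)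

Arguments Skip {Sin Sout}.
Arguments Inc {Sin Sout} _.

Ltac upd_eq :=
  apply/funext => ?; rewrite /upd;
  repeat (case: (_ =P _) => ?); try lia; try congruence;
  repeat match goal with H : ?a = _ |- _ =>
    is_var a; try rewrite H; clear H end; try lia.

Lemma updE rho b v : upd rho b v b = v.
Proof. by rewrite /upd eqxx. Qed.

Section Execution.
Variables (Sin Sout : finType).
Implicit Types (w : seq Sin) (c : cmd Sin Sout) (o : seq Sout).

Lemma exec_mono w B B' c s s' : B <= B' -> exec w B c s s' -> exec w B' c s s'.
Proof.
move=> hB; elim=> {c s s'}; try by [constructor].
- by move=> rho h o r hr; constructor; apply: leq_trans hB.
- by move=> *; econstructor; eassumption.
- by move=> *; econstructor; eassumption.
Qed.

(** Invariant rule for counting loops: [f i] is the store after [i] rounds. Each round starts with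
    the counter already decremented, and the body must leave it at that value. *)
Lemma exec_loop w B r c n (f : nat -> store Sout) s s' :
  (forall i, i <= n -> regs (f i) r = n - i) ->
  (forall i, i < n ->
     exec w B c (Store (upd (regs (f i)) r (n - i.+1)) (hpos (f i)) (out (f i)))
       (f i.+1)) ->
  s = f 0 -> s' = f n -> exec w B (Loop r c) s s'.
Proof.
move=> hr hc -> ->; elim: n f hr hc => [|n IHn] f hr hc.
  have := hr 0 isT; case: (f 0) => rho h o /= e; exact: ExLoop0.
have e0 := hr 0 isT; have h0 := hc 0 isT.
case: (f 0) e0 h0 => rho h o /= e0; rewrite subn1 => h0.
rewrite subn0 in e0; apply: (ExLoopS e0 h0).
apply: (IHn (fun i => f i.+1)) => i hi; first by rewrite hr // subSS.
by have := hc i.+1 hi; rewrite subSS.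
Qed.

Lemma exec_clear w B r rho h o :
  exec w B (Loop r Skip) (Store rho h o) (Store (upd rho r 0) h o).
Proof.
apply: (@exec_loop _ _ _ _ (rho r) (fun i => Store (upd rho r (rho r - i)) h o)) => /=.
- by move=> i _; rewrite /upd eqxx.
- move=> i _; have -> : upd (upd rho r (rho r - i)) r (rho r - i.+1) =
                       upd rho r (rho r - i.+1) by upd_eq.
  exact: ExSkip.
- by congr Store; upd_eq.
- by rewrite subnn.
Qed.

Lemma exec_move w B r q rho h o : r <> q -> rho q + rho r <= B ->
  exec w B (Loop r (Inc q)) (Store rho h o)
    (Store (upd (upd rho q (rho q + rho r)) r 0) h o).
Proof.
move=> hrq hB.
apply: (@exec_loop _ _ _ _ (rho r)
  (fun i => Store (upd (upd rho q (rho q + i)) r (rho r - i)) h o)) => /=.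
- by move=> i _; rewrite /upd eqxx.
- move=> i hi.
  set rho1 := upd (upd _ _ _) _ _.
  have -> : upd (upd rho q (rho q + i.+1)) r (rho r - i.+1) =
            upd rho1 q (rho1 q).+1 by rewrite /rho1; upd_eq.
  by apply: ExInc; rewrite /rho1 /upd; repeat (case: (_ =P _) => ?); lia.
- by congr Store; upd_eq.
- by rewrite subnn.
Qed.

End Execution.

Section Computability.
Variables (Sin Sout : finType).
Implicit Types (w : seq Sin) (c : cmd Sin Sout) (o : seq Sout).

(** A single [M] bounds the input length and all parameters. As [1 < M], constants and sums are
    absorbed by a larger exponent, so polynomial bounds compose. *)
Definition fits_in M w (e : seq nat) := [/\ 1 < M, size w <= M & all (leq^~ M) e].

Definition polyb (F : seq Sin -> seq nat -> nat) : Prop :=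
  exists k, forall w e M, fits_in M w e -> F w e <= M ^ k.

(** Registers are used as a stack: those from [b] on are zero, and each program returns them to zero
    except for its result. *)
Definition ready (M b : nat) w (rho : nat -> nat) : Prop :=
  [/\ 1 < M, size w <= M, forall r, rho r <= M & forall r, b <= r -> rho r = 0].

(* [F w e] is computed by a program that finds the values [e] of its
   parameters in any prescribed registers [xs] and writes its result in the
   first free register [b]. *)
Definition LS (F : seq Sin -> seq nat -> nat) : Prop :=
  polyb F /\ forall xs b, all (ltn^~ b) xs -> exists c k,
    forall w rho M o, ready M b w rho ->
      exec w (M ^ k) c (Store rho 0 o)
        (Store (upd rho b (F w (map rho xs))) 0 o).

Definition LSO (P : seq Sin -> seq nat -> seq Sout) : Prop :=
  forall xs b, all (ltn^~ b) xs -> exists c k,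
    forall w rho M o, ready M b w rho ->
      exec w (M ^ k) c (Store rho 0 o) (Store rho 0 (o ++ P w (map rho xs))).

Lemma ready_fits M b w rho xs : ready M b w rho -> fits_in M w (map rho xs).
Proof.
by case=> h1 h2 h3 _; split=> //; apply/allP => _ /mapP[r _ ->]; apply: h3.
Qed.

Lemma leq_exp M a b : 1 < M -> a <= b -> M ^ a <= M ^ b.
Proof. by move=> hM; rewrite leq_exp2l. Qed.

Lemma ready_upd M M' b w rho v : ready M b w rho -> M <= M' -> v <= M' ->
  ready M' b.+1 w (upd rho b v).
Proof.
case=> h1 h2 h3 h4 hM hv; split; [lia|lia| |] => r.
  by rewrite /upd; case: eqP => // _; apply: leq_trans hM.
by move=> hr; rewrite /upd; case: eqP => [|_]; [lia|apply: h4; lia].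
Qed.

Lemma map_upd rho b v xs : all (ltn^~ b) xs -> map (upd rho b v) xs = map rho xs.
Proof.
move=> /allP h; apply/eq_in_map => r /h /=; rewrite /upd.
by case: eqP => // ->; rewrite ltnn.
Qed.

Lemma all_ltnW b (xs : seq nat) : all (ltn^~ b) xs -> all (ltn^~ b.+1) xs.
Proof. by apply: sub_all => r /=; lia. Qed.

Lemma exec_weaken w k K M c s s' : 1 < M -> k <= K ->
  exec w (M ^ k) c s s' -> exec w (M ^ K) c s s'.
Proof. by move=> hM hk; apply: exec_mono; apply: leq_exp. Qed.

Lemma LS_ext F G : (forall w e, F w e = G w e) -> LS F -> LS G.
Proof. by move=> h; have -> : F = G by apply/funext => w; apply/funext. Qed.

(** Loops consume their counter, so copying a register takes a second copy in [b.+1], from which the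
    source is refilled. *)
Lemma LS_head : LS (fun _ e => head 0 e).
Proof.
split.
  by exists 1 => w [|x e] M [h1 _] //= /andP[]; rewrite expn1.
move=> [|x xs] b /=.
  exists Skip, 0 => w rho M o [_ _ _ h].
  have -> : upd rho b 0 = rho.
    by apply/funext => r; rewrite /upd; case: eqP => // ->; rewrite h.
  exact: ExSkip.
move=> /andP[hx _].
exists (Seq (Loop x (Seq (Inc b) (Inc b.+1))) (Loop b.+1 (Inc x))), 1.
move=> w rho M o [h1 h2 h3 h4]; rewrite expn1.
apply: (@ExSeq _ _ _ _ _ _ _
  (Store (upd (upd (upd rho b (rho x)) b.+1 (rho x)) x 0) 0 o)).
- apply: (@exec_loop _ _ _ _ _ _ (rho x) (fun i =>
    Store (upd (upd (upd rho b i) b.+1 i) x (rho x - i)) 0 o)) => /=.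
  + by move=> i _; rewrite /upd eqxx.
  + move=> i hi; set rho1 := upd (upd _ _ _) _ _.
    have hx3 := h3 x.
    have e1 : rho1 b = i.
      by rewrite /rho1 /upd; repeat (case: (_ =P _) => ?); lia.
    have e2 : rho1 b.+1 = i.
      by rewrite /rho1 /upd; repeat (case: (_ =P _) => ?); lia.
    have -> : upd (upd (upd rho b i.+1) b.+1 i.+1) x (rho x - i.+1) =
              upd (upd rho1 b (rho1 b).+1) b.+1 (upd rho1 b (rho1 b).+1 b.+1).+1.
      rewrite [upd rho1 _ _ b.+1]/upd; case: eqP => [|_]; first lia.
      by rewrite e1 e2 /rho1; upd_eq.
    apply: ExSeq; apply: ExInc; first by rewrite e1; lia.
    by rewrite /upd; case: eqP => [|_]; [lia|rewrite e2; lia].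
  + by congr Store; upd_eq; rewrite ?h4 //; lia.
  + by rewrite subnn.
- set rho2 := upd _ x 0.
  have e1 : rho2 x = 0 by rewrite /rho2 /upd eqxx.
  have e2 : rho2 b.+1 = rho x.
    by rewrite /rho2 /upd; repeat (case: (_ =P _) => ?); lia.
  have -> : upd rho b (rho x) = upd (upd rho2 x (rho2 x + rho2 b.+1)) b.+1 0.
    by rewrite e1 e2 /rho2; upd_eq; rewrite ?h4 //; lia.
  by apply: exec_move; [lia|rewrite e1 e2; apply: h3].
Qed.

Lemma polyb_wk F : polyb F -> polyb (fun w e => F w (behead e)).
Proof.
case=> k h; exists k => w e M [h1 h2 h3]; apply: h; split=> //.
by case: e h3 => //= x e /andP[].
Qed.

Lemma LS_wk F : LS F -> LS (fun w e => F w (behead e)).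
Proof.
case=> hp h; split; first exact: polyb_wk.
move=> xs b hx; have hx' : all (ltn^~ b) (behead xs).
  by case: xs hx => //= x e /andP[].
have [c [k hc]] := h _ _ hx'; exists c, k => w rho M o hr.
by rewrite behead_map; apply: hc.
Qed.

Lemma LS_const n : LS (fun _ _ => n).
Proof.
split.
  by exists n => w e M [h1 _ _]; apply: ltnW; apply: ltn_expl.
move=> xs b _; exists (iter n (fun c => Seq c (Inc b)) Skip), n =>
  w rho M o [h1 h2 h3 h4].
have hn : n <= M ^ n by apply: ltnW; apply: ltn_expl.
move: (M ^ n) hn => B hB.
elim: n hB => [|n IHn] hB /=.
  have -> : upd rho b 0 = rho.
    by apply/funext => r; rewrite /upd; case: eqP => // ->; rewrite h4.
  exact: ExSkip.
apply: ExSeq; first by apply: IHn; lia.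
have -> : upd rho b n.+1 = upd (upd rho b n) b (upd rho b n b).+1.
  by rewrite updE; upd_eq.
by apply: ExInc; rewrite /upd eqxx.
Qed.

Lemma LS_succ F : LS F -> LS (fun w e => (F w e).+1).
Proof.
case=> -[kF hF] h; split.
  exists kF.+1 => w e M hM; have := hF w e M hM; case: hM => h1 _ _ h2.
  by rewrite expnS; apply: leq_trans (_ : 2 * M ^ kF <= _);
    rewrite ?leq_mul2r ?h1 ?orbT //; lia.
move=> xs b hx; have [c [k hc]] := h _ _ hx.
exists (Seq c (Inc b)), (k + kF.+1) => w rho M o hr.
have hM : 1 < M by case: hr.
apply: ExSeq; first by apply: (exec_weaken hM _ (hc _ _ _ _ hr)); lia.
set v := F w _.
have -> : upd rho b v.+1 = upd (upd rho b v) b (upd rho b v b).+1.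
  by rewrite updE; upd_eq.
apply: ExInc; rewrite /upd eqxx.
have hv : v <= M ^ kF by apply: hF; apply: ready_fits hr.
apply: (leq_ltn_trans hv); rewrite ltn_exp2l //; lia.
Qed.

(** Composition: the intermediate value occupies [b] while [G] runs and puts its result in [b.+1];
    then [b] is cleared and the result moved down. *)
Lemma LS_let_drop m H G : LS H -> LS G ->
  LS (fun w e => G w (H w e :: drop m e)).
Proof.
case=> -[kH hH] h [[kG hG] g].
have hd b (xs : seq nat) : all (ltn^~ b) xs -> all (ltn^~ b) (drop m xs).
  by move=> /allP hx; apply/allP => r /mem_drop; apply: hx.
split.
  (* The successor makes the new bound [M ^ kH.+1] exceed [M] too, even when [kH] is 0, so that it
     covers the old parameters. *)
  exists (kH.+1 * kG) => w e M hM; rewrite expnM; apply: hG.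
  case: (hM) => h1 h2 h3.
  have hM1 : M <= M ^ kH.+1 by rewrite -{1}(expn1 M) leq_exp.
  split; [lia|lia|]; apply/allP => r; rewrite inE => /orP[/eqP->|/mem_drop hr].
    by apply: leq_trans (hH _ _ _ hM) _; rewrite leq_exp.
  by apply: leq_trans hM1; apply: (allP h3).
move=> xs b hx; have [ch [k1 hch]] := h _ _ hx.
have hx' : all (ltn^~ b.+1) (b :: drop m xs).
  by rewrite /= ltnSn all_ltnW // hd.
have [cg [k2 hcg]] := g _ _ hx'.
exists (Seq ch (Seq cg (Seq (Loop b Skip) (Loop b.+1 (Inc b))))),
  (k1 + kH.+1 * k2 + kH.+1 * kG) => w rho M o hr.
have hM : 1 < M by case: hr.
apply: ExSeq; first by apply: (exec_weaken hM _ (hch _ _ _ _ hr)); lia.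
set v := H w _.
have hv : v <= M ^ kH.+1.
  apply: (@leq_trans (M ^ kH)); last by rewrite leq_exp.
  exact: hH (ready_fits _ hr).
have hr1 : ready (M ^ kH.+1) b.+1 w (upd rho b v).
  by apply: (ready_upd hr) => //; rewrite -{1}(expn1 M) leq_exp.
apply: ExSeq.
  have := hcg w _ _ o hr1; rewrite -expnM => hh.
  by apply: (exec_weaken hM _ hh); lia.
rewrite [map _ _]/= map_upd ?hd // map_drop updE.
set u := G w _.
have hu : u <= M ^ (kH.+1 * kG).
  rewrite expnM; apply: hG; have := ready_fits (b :: drop m xs) hr1.
  by rewrite /= map_upd ?hd // map_drop updE.
apply: ExSeq; first exact: exec_clear.
set rho1 := upd _ b 0.
have e1 : rho1 b = 0 by rewrite /rho1 /upd eqxx.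
have e2 : rho1 b.+1 = u.
  by rewrite /rho1 /upd; repeat (case: (_ =P _) => ?); lia.
have -> : upd rho b u = upd (upd rho1 b (rho1 b + rho1 b.+1)) b.+1 0.
  case: hr => _ _ _ h4.
  by rewrite e1 e2 /rho1; upd_eq; rewrite ?h4 //; lia.
apply: exec_move; first by lia.
rewrite e1 e2; apply: (leq_trans hu); apply: leq_exp => //; lia.
Qed.

(** The head walks to the cell and back with the same number of moves. If the right end stopped it
    early, the surplus left moves are absorbed at cell 0. *)
Lemma LS_cell (p : pred (icell Sin)) F : LS F ->
  LS (fun w e => nat_of_bool (p (icell_at w (F w e)))).
Proof.
case=> -[kF hF] h; split.
  by exists 0 => w e M _; rewrite expn0; case: (p _).
move=> xs b hx; have [c [k hc]] := h _ _ hx.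
exists (Seq c (Seq (Loop b (Seq (Head _ _ MoveRight) (Inc b.+1)))
         (Seq (IfCell p (Inc b) Skip) (Loop b.+1 (Head _ _ MoveLeft))))),
  (k + kF) => w rho M o hr.
have hM : 1 < M by case: hr.
apply: ExSeq; first by apply: (exec_weaken hM _ (hc _ _ _ _ hr)); lia.
set v := F w _.
have hv : v <= M ^ (k + kF).
  apply: (@leq_trans (M ^ kF)); last by apply: leq_exp => //; lia.
  exact: hF (ready_fits _ hr).
have hB : 0 < M ^ (k + kF) by rewrite expn_gt0; lia.
have [_ _ _ h4] := hr.
move: (M ^ _) hv hB => B hv hB.
set pos := minn v (size w).+1.
apply: (@ExSeq _ _ _ _ _ _ _ (Store (upd (upd rho b 0) b.+1 v) pos o)).
  apply: (@exec_loop _ _ _ _ _ _ v (fun i =>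
    Store (upd (upd rho b (v - i)) b.+1 i) (minn i (size w).+1) o)) => /=.
  - by move=> i _; rewrite /upd; do ![case: (_ =P _) => // ?]; lia.
  - move=> i hi; apply: ExSeq; first exact: ExHead.
    set rho1 := upd (upd _ _ _) _ _.
    have e1 : rho1 b.+1 = i by rewrite /rho1 /upd; do ![case: (_ =P _) => // ?]; lia.
    have -> : upd (upd rho b (v - i.+1)) b.+1 i.+1 = upd rho1 b.+1 (rho1 b.+1).+1.
      by rewrite e1 /rho1; upd_eq.
    have -> : minn (Defs.shift MoveRight (minn i (size w).+1)) (size w).+1 =
              minn i.+1 (size w).+1 by rewrite /=; lia.
    by apply: ExInc; rewrite e1; lia.
  - by congr Store; upd_eq; rewrite ?h4 //; lia.
  - by rewrite subnn.
(* Every position past the word counts as [RightEnd], so a head that was stopped there reads the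
   right answer. *)
have ec : icell_at w v = icell_at w pos.
  rewrite /pos; case: (leqP v (size w).+1) => // hs.
  by case: v hs {hv pos} => // v hs; rewrite /= !onth_default //; lia.
apply: (@ExSeq _ _ _ _ _ _ _ (Store (upd (upd rho b (p (icell_at w v))) b.+1 v) pos o)).
  apply: ExIf; rewrite ec; case: (p _); last exact: ExSkip.
  set rho1 := upd (upd rho b 0) _ _.
  have e1 : rho1 b = 0 by rewrite /rho1 /upd; do ![case: (_ =P _) => // ?]; lia.
  have -> : upd (upd rho b true) b.+1 v = upd rho1 b (rho1 b).+1.
    by rewrite e1 /rho1; upd_eq.
  by apply: ExInc; rewrite e1.
apply: (@exec_loop _ _ _ _ _ _ v (fun i =>
    Store (upd (upd rho b (p (icell_at w v))) b.+1 (v - i)) (pos - i) o)) => /=.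
- by move=> i _; rewrite /upd eqxx.
- move=> i hi.
  have -> : upd (upd rho b (p (icell_at w v))) b.+1 (v - i.+1) =
    upd (upd (upd rho b (p (icell_at w v))) b.+1 (v - i)) b.+1 (v - i.+1) by upd_eq.
  have -> : pos - i.+1 = minn (Defs.shift MoveLeft (pos - i)) (size w).+1.
    by rewrite /pos /=; lia.
  exact: ExHead.
- by rewrite !subn0.
- have -> : pos - v = 0 by rewrite /pos; lia.
  by congr Store; upd_eq; rewrite ?h4 //; lia.
Qed.


(** Registers [b] to [b.+3] hold the rounds left, the accumulator, the index and the new value. The
    bound [C] on all intermediate values is indispensable, since an iteration of polynomially
    bounded steps can grow beyond any polynomial. *)
Lemma LS_rec_cons N I S C : LS N -> LS I -> LS S -> polyb C ->
  (forall w e i, i <= N w e ->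
     iteri i (fun j acc => S w [:: j, acc & e]) (I w e) <= C w e) ->
  LS (fun w e => iteri (N w e) (fun j acc => S w [:: j, acc & e]) (I w e)).
Proof.
case=> -[kN hN] lN [[kI hI] lI] [[kS hS] lS] [kC hC] hb.
split; first by exists kC => w e M hM; apply: leq_trans (hC _ _ _ hM); apply: hb.
move=> xs b hx; have [cN [k1 hc1]] := lN _ _ hx.
have hx1 := all_ltnW hx; have hx2 := all_ltnW hx1; have hx3 := all_ltnW hx2.
have [cI [k2 hc2]] := lI _ _ hx1.
have hx' : all (ltn^~ b.+3) [:: b.+2, b.+1 & xs] by rewrite /= hx3; lia.
have [cS [k3 hc3]] := lS _ _ hx'.
pose k0 := (kN + kC).+1.
exists (Seq cN (Seq cI (Seq (Loop b (Seq cS (Seq (Loop b.+1 Skip)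
          (Seq (Loop b.+3 (Inc b.+1)) (Inc b.+2)))))
        (Seq (Loop b.+2 Skip) (Loop b.+1 (Inc b)))))),
  (k1 + k0 * k2 + k0 * k3 + k0) => w rho M o hr.
have hM : 1 < M by case: hr.
have hfit := ready_fits xs hr.
set K := _ + k0.
set n := N w _.
pose R i := iteri i (fun j acc => S w [:: j, acc & map rho xs]) (I w (map rho xs)).
rewrite -/(R n).
have hn : n <= M ^ k0.
  by apply: leq_trans (hN _ _ _ hfit) _; apply: leq_exp => //; rewrite /k0; lia.
have hR i : i <= n -> R i <= M ^ k0.
  move=> hi; apply: leq_trans (hb _ _ _ hi) _; apply: leq_trans (hC _ _ _ hfit) _.
  by apply: leq_exp => //; rewrite /k0; lia.
have hM0 : M <= M ^ k0 by rewrite -{1}(expn1 M) leq_exp.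
have hK : M ^ k0 <= M ^ K by apply: leq_exp => //; rewrite /K; lia.
apply: ExSeq; first by apply: (exec_weaken hM _ (hc1 _ _ _ _ hr)); rewrite /K; lia.
have hr1 : ready (M ^ k0) b.+1 w (upd rho b n) by apply: (ready_upd hr).
apply: ExSeq.
  have := hc2 w _ _ o hr1; rewrite -expnM => hh.
  by apply: (exec_weaken hM _ hh); rewrite /K; lia.
rewrite map_upd // -[I w _]/(R 0).
have [_ _ _ h4] := hr.
apply: (@ExSeq _ _ _ _ _ _ _
  (Store (upd (upd (upd rho b 0) b.+1 (R n)) b.+2 n) 0 o)).
  apply: (@exec_loop _ _ _ _ _ _ n (fun i =>
    Store (upd (upd (upd rho b (n - i)) b.+1 (R i)) b.+2 i) 0 o)) => /=.
  - by move=> i _; rewrite /upd; repeat (case: (_ =P _) => ?); lia.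
  - move=> i hi; set rho1 := upd _ b _.
    have hr2 : ready (M ^ k0) b.+3 w rho1.
      split; [lia|case: hr; lia| |] => r; rewrite /rho1 /upd.
        repeat (case: (_ =P _) => ?); [lia|lia|apply: hR; lia|].
        by apply: leq_trans hM0; case: hr.
      by move=> h; repeat (case: (_ =P _) => ?); try lia; apply: h4; lia.
    apply: ExSeq.
      have := hc3 w _ _ o hr2; rewrite -expnM => hh.
      by apply: (exec_weaken hM _ hh); rewrite /K; lia.
    have e1 : map rho1 [:: b.+2, b.+1 & xs] = [:: i, R i & map rho xs].
      rewrite /= /rho1 map_upd // map_upd // map_upd // map_upd //.
      by congr [:: _, _ & _]; rewrite /upd; repeat (case: (_ =P _) => ?); lia.
    rewrite e1 -[S w _]/(R i.+1).
    apply: ExSeq; first exact: exec_clear.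
    set rho2 := upd _ b.+1 0.
    have e2 : rho2 b.+3 = R i.+1.
      by rewrite /rho2 /upd; repeat (case: (_ =P _) => ?); lia.
    have e3 : rho2 b.+1 = 0.
      by rewrite /rho2 /upd; repeat (case: (_ =P _) => ?); lia.
    apply: ExSeq.
      apply: exec_move; first lia.
      by rewrite e2 e3; apply: leq_trans hK; apply: hR; lia.
    set rho3 := upd _ b.+3 0.
    have e4 : rho3 b.+2 = i.
      rewrite /rho3 /rho2 /rho1 /upd.
      by repeat (case: (_ =P _) => ?); lia.
    have -> : upd (upd (upd rho b (n - i.+1)) b.+1 (R i.+1)) b.+2 i.+1 =
              upd rho3 b.+2 (rho3 b.+2).+1.
      rewrite e4 /rho3 e2 e3 /rho2 /rho1 add0n.
      by upd_eq; rewrite ?h4 //; lia.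
    by apply: ExInc; rewrite e4; apply: leq_trans hK; lia.
  - by rewrite subn0; congr Store; upd_eq; rewrite ?h4 //; lia.
  - by rewrite subnn.
apply: ExSeq; first exact: exec_clear.
set rho4 := upd _ b.+2 0.
have e1 : rho4 b = 0 by rewrite /rho4 /upd; repeat (case: (_ =P _) => ?); lia.
have e2 : rho4 b.+1 = R n by rewrite /rho4 /upd; repeat (case: (_ =P _) => ?); lia.
have -> : upd rho b (R n) = upd (upd rho4 b (rho4 b + rho4 b.+1)) b.+1 0.
  by rewrite e1 e2 /rho4; upd_eq; rewrite ?h4 //; lia.
apply: exec_move; first by lia.
by rewrite e1 e2; apply: leq_trans hK; apply: hR.
Qed.

(** Bound variables are de Bruijn indices: in the step, parameter 0 is the index, parameter 1 the
    accumulator, and the outer parameters follow. *)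
Lemma LS_rec N I (S : seq Sin -> seq nat -> nat -> nat -> nat) C :
  LS N -> LS I ->
  LS (fun w e => S w (behead (behead e)) (head 0 e) (head 0 (behead e))) ->
  polyb C ->
  (forall w e i, i <= N w e -> iteri i (S w e) (I w e) <= C w e) ->
  LS (fun w e => iteri (N w e) (S w e) (I w e)).
Proof. by move=> hN hI hS; apply: (LS_rec_cons hN hI hS). Qed.

Lemma LSO_ext P Q : (forall w e, P w e = Q w e) -> LSO P -> LSO Q.
Proof. by move=> h; have -> : P = Q by apply/funext => w; apply/funext. Qed.

Lemma LSO_nil : LSO (fun _ _ => [::]).
Proof.
move=> xs b _; exists Skip, 0 => w rho M o _; rewrite cats0; exact: ExSkip.
Qed.

Lemma LSO_emit a : LSO (fun _ _ => [:: a]).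
Proof.
move=> xs b _; exists (Emit _ a), 0 => w rho M o _; rewrite cats1; exact: ExEmit.
Qed.

Lemma LSO_cat P Q : LSO P -> LSO Q -> LSO (fun w e => P w e ++ Q w e).
Proof.
move=> hP hQ xs b hx; have [c [k hc]] := hP _ _ hx.
have [d [l hd]] := hQ _ _ hx.
exists (Seq c d), (k + l) => w rho M o hr.
have hM : 1 < M by case: hr.
rewrite catA; apply: ExSeq.
  by apply: (exec_weaken hM _ (hc _ _ _ _ hr)); lia.
by apply: (exec_weaken hM _ (hd _ _ _ _ hr)); lia.
Qed.

Lemma LSO_wk P : LSO P -> LSO (fun w e => P w (behead e)).
Proof.
move=> h xs b hx; have hx' : all (ltn^~ b) (behead xs).
  by case: xs hx => //= x e /andP[].
have [c [k hc]] := h _ _ hx'; exists c, k => w rho M o hr.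
by rewrite behead_map; apply: hc.
Qed.

Lemma LSO_for_cons N P : LS N -> LSO P ->
  LSO (fun w e => flatten [seq P w (i :: e) | i <- iota 0 (N w e)]).
Proof.
case=> -[kN hN] lN hP xs b hx; have [cN [k1 hc1]] := lN _ _ hx.
have hx' : all (ltn^~ b.+2) (b.+1 :: xs) by rewrite /= all_ltnW ?all_ltnW //; lia.
have [cP [k2 hc2]] := hP _ _ hx'.
exists (Seq cN (Seq (Loop b (Seq cP (Inc b.+1))) (Loop b.+1 Skip))),
  (k1 + kN.+1 * k2 + kN.+1) => w rho M o hr.
have hM : 1 < M by case: hr.
set K := _ + kN.+1.
apply: ExSeq; first by apply: (exec_weaken hM _ (hc1 _ _ _ _ hr)); rewrite /K; lia.
set n := N w _.
have hn : n <= M ^ kN.+1.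
  apply: leq_trans (hN _ _ _ (ready_fits xs hr)) _; exact: leq_exp.
have [_ _ h3 h4] := hr.
have hM0 : M <= M ^ kN.+1 by rewrite -{1}(expn1 M) leq_exp.
have hK : M ^ kN.+1 <= M ^ K by apply: leq_exp => //; rewrite /K; lia.
pose O i := flatten [seq P w (i :: map rho xs) | i <- iota 0 i].
apply: (@ExSeq _ _ _ _ _ _ _ (Store (upd (upd rho b 0) b.+1 n) 0 (o ++ O n))).
  apply: (@exec_loop _ _ _ _ _ _ n (fun i =>
    Store (upd (upd rho b (n - i)) b.+1 i) 0 (o ++ O i))) => /=.
  - by move=> i _; rewrite /upd; repeat (case: (_ =P _) => ?); lia.
  - move=> i hi; set rho1 := upd _ b _.
    have hr2 : ready (M ^ kN.+1) b.+2 w rho1.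
      split; [lia|case: hr; lia| |] => r; rewrite /rho1 /upd.
        by repeat (case: (_ =P _) => ?); [lia|lia|apply: leq_trans hM0].
      by move=> h; repeat (case: (_ =P _) => ?); try lia; apply: h4; lia.
    apply: ExSeq.
      have := hc2 w _ _ (o ++ O i) hr2; rewrite -expnM => hh.
      by apply: (exec_weaken hM _ hh); rewrite /K; lia.
    have e1 : map rho1 (b.+1 :: xs) = i :: map rho xs.
      rewrite /= /rho1 map_upd // map_upd ?all_ltnW // map_upd //.
      by congr (_ :: _); rewrite /upd; repeat (case: (_ =P _) => ?); lia.
    have e2 : rho1 b.+1 = i.
      by rewrite /rho1 /upd; repeat (case: (_ =P _) => ?); lia.
    rewrite e1 -catA.
    have -> : O i ++ P w (i :: map rho xs) = O i.+1.
      by rewrite /O -addn1 iotaD map_cat flatten_cat /= cats0.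
    have -> : upd (upd rho b (n - i.+1)) b.+1 i.+1 = upd rho1 b.+1 (rho1 b.+1).+1.
      by rewrite e2 /rho1; upd_eq.
    by apply: ExInc; rewrite e2; apply: leq_trans hK; lia.
  - rewrite subn0 /O /= cats0; congr Store.
    by upd_eq; rewrite ?h4 //; lia.
  - by rewrite subnn.
have := exec_clear w (M ^ K) b.+1 (upd (upd rho b 0) b.+1 n) 0 (o ++ O n).
have -> // : upd (upd (upd rho b 0) b.+1 n) b.+1 0 = rho.
by upd_eq; rewrite ?h4 //; lia.
Qed.

Lemma LSO_for N (P : seq Sin -> seq nat -> nat -> seq Sout) :
  LS N -> LSO (fun w e => P w (behead e) (head 0 e)) ->
  LSO (fun w e => flatten [seq P w e i | i <- iota 0 (N w e)]).
Proof. exact: LSO_for_cons. Qed.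

Lemma LSO_logspace P : LSO P ->
  exists T : transducer Sin Sout, logspace T /\ forall w, outputs T w (P w [::]).
Proof.
move=> hP; have [c [k hc]] := hP [::] 0 isT.
(* The parameter [M] is [size w + 2]. With [l] the truncated logarithm, [size w + 2 <= 2 ^ (l + 2)],
   and [(l + 2) k < (2 k + 1) (l + 1)]. *)
apply: (@exec_logspace _ _ c (2 * k + 1)) => w.
exists ((size w + 2) ^ k), (fun=> 0); split.
  set l := (trunc_log 2 (size w)).
  have hl : size w + 2 <= 2 ^ l.+2.
    have := @trunc_log_ltn 2 (size w) isT; rewrite -/l !expnS => ?.
    have : 0 < 2 ^ l by rewrite expn_gt0.
    lia.
  apply: (@leq_ltn_trans (2 ^ (l.+2 * k))).
    by rewrite expnM; case: k {hc} => // k; rewrite leq_exp2r.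
  by rewrite ltn_exp2l //; nia.
have := hc w (fun=> 0) (size w + 2) [::]; rewrite cat0s; apply.
by split=> //; lia.
Qed.

End Computability.

(** * Arithmetic of small numbers *)

Section Arithmetic.
Variables (Sin Sout : finType).
Notation LS := (@LS Sin Sout).
Notation LSO := (@LSO Sin Sout).
Implicit Types F G : seq Sin -> seq nat -> nat.

Lemma LS_var k : LS (fun _ e => head 0 (iter k behead e)).
Proof.
elim: k => [|k IHk]; first exact: LS_head.
by apply: LS_ext (LS_wk IHk) => w e; rewrite -iterSr.
Qed.

Lemma LS_wk_iter k F : LS F -> LS (fun w e => F w (iter k behead e)).
Proof.
move=> hF; elim: k => [//|k IHk].
by apply: LS_ext (LS_wk IHk) => w e; rewrite -iterSr.
Qed.

Lemma LS_wk2 F : LS F -> LS (fun w e => F w (behead (behead e))).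
Proof. exact: (@LS_wk_iter 2). Qed.

Lemma LS_var1 : LS (fun _ e => head 0 (behead e)).
Proof. exact: (LS_var 1). Qed.

(** Substitution under binders: [G] may depend on the [k] innermost bound variables, of which [F]
    knows nothing. *)
Lemma LS_app k (F : seq Sin -> seq nat -> nat -> nat) G :
  LS (fun w e => F w (behead e) (head 0 e)) -> LS G ->
  LS (fun w e => F w (iter k behead e) (G w e)).
Proof.
move=> hF hG; have := LS_let_drop k hG hF; apply: LS_ext => w e /=.
congr F; elim: k e => [|k IHk] e; first by rewrite drop0.
by rewrite iterSr -IHk -drop1 drop_drop addn1.
Qed.

Lemma LS_polyb F : LS F -> polyb F. Proof. by case. Qed.

Lemma fits_in_exp M (w : seq Sin) e k : fits_in M w e -> fits_in (M ^ k.+1) w e.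
Proof.
case=> h1 h2 h3; have h : M <= M ^ k.+1 by rewrite -{1}(expn1 M) leq_exp.
split; [lia|lia|]; apply/allP => r hr.
by apply: leq_trans h; apply: (allP h3).
Qed.

Lemma polyb_bin (op : nat -> nat -> nat) F G :
  (forall m n, op m n <= (m + n).+1 * (m + n).+1) -> polyb F -> polyb G ->
  polyb (fun w e => op (F w e) (G w e)).
Proof.
move=> hop [k hF] [l hG]; exists (2 * (k + l).+2) => w e M hM.
have h1 : 1 < M by case: hM.
apply: leq_trans (hop _ _) _; rewrite mul2n -addnn expnD.
have hm : 0 < M ^ (k + l) by rewrite expn_gt0; lia.
have h : (F w e + G w e).+1 <= M ^ (k + l).+2.
  have := hF _ _ _ hM; have := hG _ _ _ hM.
  have : M ^ k <= M ^ (k + l) by apply: leq_exp => //; lia.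
  have : M ^ l <= M ^ (k + l) by apply: leq_exp => //; lia.
  move=> hk hl h2 h3; apply: (@leq_trans (2 * 2 * M ^ (k + l))); first lia.
  by rewrite !expnS mulnA leq_mul2r (leq_mul h1 h1) orbT.
exact: leq_mul.
Qed.

Lemma LS_add F G : LS F -> LS G -> LS (fun w e => F w e + G w e).
Proof.
move=> hF hG.
apply: (LS_ext (F := fun w e => iteri (G w e) (fun _ acc => acc.+1) (F w e))).
  by move=> w e; elim: (G w e) => [|n IHn] /=; rewrite ?addn0 // IHn addnS.
apply: (LS_rec (C := fun w e => F w e + G w e) hG hF).
- by apply: LS_succ; apply: LS_var1.
- apply: (polyb_bin (op := addn)); [|exact: LS_polyb|exact: LS_polyb].
  by move=> m n; nia.
- move=> w e i hi; apply: (@leq_trans (F w e + i)); last by rewrite leq_add2l.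
  by elim: i {hi} => [|i IHi] /=; lia.
Qed.

Lemma LS_mul F G : LS F -> LS G -> LS (fun w e => F w e * G w e).
Proof.
move=> hF hG.
apply: (LS_ext (F := fun w e => iteri (G w e) (fun _ acc => acc + F w e) 0)).
  by move=> w e; elim: (G w e) => [|n IHn] /=; rewrite ?muln0 // IHn mulnS addnC.
apply: (LS_rec (C := fun w e => F w e * G w e) hG (LS_const _ _ 0)).
- by apply: LS_add; [exact: LS_var1|exact: LS_wk2].
- apply: (polyb_bin (op := muln)); [|exact: LS_polyb|exact: LS_polyb].
  by move=> m n; nia.
- move=> w e i hi; apply: (@leq_trans (F w e * i)); last by rewrite leq_mul2l hi orbT.
  by elim: i {hi} => [|i IHi] //=; rewrite mulnS; lia.
Qed.

(** The last index of a loop of [n] rounds is [n.-1]; with no round the initial 0 remains. *)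
Lemma LS_pred F : LS F -> LS (fun w e => (F w e).-1).
Proof.
move=> hF; apply: (LS_ext (F := fun w e => iteri (F w e) (fun i _ => i) 0)).
  by move=> w e; case: (F w e).
apply: (LS_rec (C := F) hF (LS_const _ _ 0)).
- exact: LS_head.
- exact: LS_polyb.
- by move=> w e [|i] //= hi; lia.
Qed.

Lemma LS_sub F G : LS F -> LS G -> LS (fun w e => F w e - G w e).
Proof.
move=> hF hG.
apply: (LS_ext (F := fun w e => iteri (G w e) (fun _ acc => acc.-1) (F w e))).
  by move=> w e; elim: (G w e) => [|n IHn] /=; rewrite ?subn0 // IHn subnS.
apply: (LS_rec (C := F) hG hF).
- by apply: LS_pred; apply: LS_var1.
- exact: LS_polyb.
- by move=> w e i _; elim: i => [|i IHi] //=; lia.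
Qed.

Lemma LS_eq0 F : LS F -> LS (fun w e => nat_of_bool (F w e == 0)).
Proof.
move=> hF; apply: (LS_ext (F := fun w e => 1 - F w e)).
  by move=> w e; case: (F w e) => // n; rewrite subSS sub0n.
exact: (LS_sub (LS_const _ _ 1)).
Qed.

Lemma LS_leq F G : LS F -> LS G -> LS (fun w e => nat_of_bool (F w e <= G w e)).
Proof. by move=> hF hG; apply: LS_eq0; apply: LS_sub. Qed.

Lemma LS_ltn F G : LS F -> LS G -> LS (fun w e => nat_of_bool (F w e < G w e)).
Proof. by move=> hF; apply: LS_leq; apply: LS_succ. Qed.

Lemma LS_and (P Q : seq Sin -> seq nat -> bool) :
  LS (fun w e => nat_of_bool (P w e)) -> LS (fun w e => nat_of_bool (Q w e)) ->
  LS (fun w e => nat_of_bool (P w e && Q w e)).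
Proof.
move=> hP hQ; apply: (LS_ext _ (LS_mul hP hQ)) => w e.
by case: (P w e); case: (Q w e).
Qed.

Lemma LS_not (P : seq Sin -> seq nat -> bool) :
  LS (fun w e => nat_of_bool (P w e)) -> LS (fun w e => nat_of_bool (~~ P w e)).
Proof.
by move=> hP; apply: (LS_ext _ (LS_eq0 hP)) => w e; case: (P w e).
Qed.

Lemma LS_imp (P Q : seq Sin -> seq nat -> bool) :
  LS (fun w e => nat_of_bool (P w e)) -> LS (fun w e => nat_of_bool (Q w e)) ->
  LS (fun w e => nat_of_bool (P w e ==> Q w e)).
Proof.
move=> hP hQ; apply: (LS_ext _ (LS_not (LS_and hP (LS_not hQ)))) => w e.
by case: (P w e); case: (Q w e).
Qed.

Lemma LS_eqn F G : LS F -> LS G -> LS (fun w e => nat_of_bool (F w e == G w e)).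
Proof.
move=> hF hG; apply: (LS_ext _ (LS_and (LS_leq hF hG) (LS_leq hG hF))) => w e.
by rewrite eqn_leq.
Qed.

Lemma LS_if (P : seq Sin -> seq nat -> bool) F G :
  LS (fun w e => nat_of_bool (P w e)) -> LS F -> LS G ->
  LS (fun w e => if P w e then F w e else G w e).
Proof.
move=> hP hF hG.
apply: (LS_ext _ (LS_add (LS_mul hP hF) (LS_mul (LS_not hP) hG))) => w e.
by case: (P w e); lia.
Qed.

Lemma LS_sum N (F : seq Sin -> seq nat -> nat -> nat) :
  LS N -> LS (fun w e => F w (behead e) (head 0 e)) ->
  LS (fun w e => \sum_(0 <= i < N w e) F w e i).
Proof.
move=> hN hF.
pose R w e i := iteri i (fun j acc => acc + F w e j) 0.
have hR w e i : R w e i = \sum_(j < i) F w e j.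
  by elim: i => [|i IHi]; rewrite /R /= ?big_ord0 // big_ord_recr -IHi.
apply: (LS_ext (F := fun w e => R w e (N w e))) => [w e|].
  by rewrite hR big_mkord.
apply: (LS_rec (C := fun w e => R w e (N w e)) hN (LS_const _ _ 0)).
- apply: LS_add; first exact: LS_var1.
  exact: (@LS_app 2 F _ hF (LS_head _ _)).
- case: hN hF => -[kN hN] _ [[kF hF] _]; exists (kN + kN.+1 * kF) => w e M hM.
  rewrite hR; have hn := hN _ _ _ hM.
  have h1 : 1 < M by case: hM.
  apply: (@leq_trans (\sum_(j < N w e) M ^ (kN.+1 * kF))).
    apply: leq_sum => j _; rewrite expnM; apply: (hF w (nat_of_ord j :: e)).
    have [h2 h3 h4] := fits_in_exp kN hM.
    split=> //=; rewrite h4 andbT.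
    apply: leq_trans (_ : M ^ kN <= _); last exact: leq_exp.
    by apply: leq_trans hn; apply: ltnW.
  by rewrite sum_nat_const card_ord expnD leq_mul2r hn orbT.
- move=> w e i hi; rewrite -/(R w e i) !hR.
  by rewrite -(subnKC hi) big_split_ord /= leq_addr.
Qed.

Lemma LS_odd F : LS F -> LS (fun w e => nat_of_bool (odd (F w e))).
Proof.
move=> hF; pose R i := iteri i (fun _ acc => 1 - acc) 0.
have hR i : R i = odd i.
  by elim: i => //= i IHi; rewrite /R /= -/(R i) IHi; case: (odd i).
apply: (LS_ext (F := fun w e => R (F w e))) => [w e|]; first exact: hR.
apply: (LS_rec (C := fun _ _ => 1) hF (LS_const _ _ 0)).
- apply: LS_sub; first exact: LS_const.
  exact: LS_var1.
- by apply: LS_polyb (LS_const _ Sout 1).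
- by move=> w e i _; rewrite -/(R i) hR; case: (odd i).
Qed.

(** Half of [n] is the number of odd integers below [n]. *)
Lemma LS_half F : LS F -> LS (fun w e => (F w e)./2).
Proof.
move=> hF; apply: (LS_ext (F := fun w e => \sum_(0 <= i < F w e) nat_of_bool (odd i))).
  move=> w e; elim: (F w e) => [|n IHn]; first by rewrite big_nil.
  by rewrite big_nat_recr //= IHn uphalf_half addnC.
by apply: LS_sum => //; apply: LS_odd; apply: LS_head.
Qed.

Lemma LS_has N (P : seq Sin -> seq nat -> nat -> bool) :
  LS N -> LS (fun w e => nat_of_bool (P w (behead e) (head 0 e))) ->
  LS (fun w e => nat_of_bool (has (P w e) (iota 0 (N w e)))).
Proof.
move=> hN hP; have := LS_not (LS_eq0 (LS_sum (F := fun w e i =>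
  nat_of_bool (P w e i)) hN hP)).
apply: LS_ext => w e; congr nat_of_bool; elim: (N w e) => [|n IHn].
  by rewrite big_nil.
rewrite big_nat_recr // -addn1 iotaD has_cat addn_eq0 negb_and IHn /= orbF.
by case: (P w e n).
Qed.

Lemma LS_all N (P : seq Sin -> seq nat -> nat -> bool) :
  LS N -> LS (fun w e => nat_of_bool (P w (behead e) (head 0 e))) ->
  LS (fun w e => nat_of_bool (all (P w e) (iota 0 (N w e)))).
Proof.
move=> hN hP.
have := LS_not (LS_has (P := fun w e i => ~~ P w e i) hN (LS_not hP)).
by apply: LS_ext => w e; rewrite has_predC negbK.
Qed.

(** The first witness is the number of indices [i] such that no [j <= i] is a witness; without any
    witness this count is [N], as for [find]. *)
Lemma LS_find N (P : seq Sin -> seq nat -> nat -> bool) :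
  LS N -> LS (fun w e => nat_of_bool (P w (behead e) (head 0 e))) ->
  LS (fun w e => find (P w e) (iota 0 (N w e))).
Proof.
move=> hN hP.
have hH : LS (fun w e => nat_of_bool
    (~~ has (P w (behead e)) (iota 0 (head 0 e).+1))).
  apply: LS_not; apply: (LS_has (P := fun w e => P w (behead e))).
    exact/LS_succ/LS_head.
  exact: (@LS_app 2 (fun w e i => nat_of_bool (P w e i)) _ hP (LS_head _ _)).
have := LS_sum (F := fun w e i => nat_of_bool (~~ has (P w e) (iota 0 i.+1))) hN hH.
apply: LS_ext => w e; elim: (N w e) => [|n IHn]; first by rewrite big_nil.
have e1 : iota 0 n.+1 = iota 0 n ++ [:: n] by rewrite -addn1 iotaD.
rewrite big_nat_recr // [X in X + _ = _]IHn e1 has_cat find_cat size_iota;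
  case: (boolP (has _ _)) => [h|h] /=.
  by rewrite addn0.
by rewrite (hasNfind h) size_iota; case: (P w e n).
Qed.

(** A loop ends only when its register is zero, so a flag in [b.+2] imitates an exit test: each
    round consumes it, and the body sets it again unless the right end marker is read. The second
    count, in [b.+1], brings the head back. *)
Lemma LS_size_succ : LS (fun w _ => (size w).+1).
Proof.
split.
  exists 2 => w e M [h1 h2 _]; rewrite -mulnn.
  by apply: leq_trans (_ : 2 * M <= _); [lia|rewrite leq_mul2r h1 orbT].
move=> xs b _.
pose body : cmd Sin Sout := IfCell (fun x => if x is RightEnd then true else false)
  Skip (Seq (Head _ _ MoveRight) (Seq (Inc b) (Seq (Inc b.+1) (Inc b.+2)))).
exists (Seq (Inc b.+2) (Seq (Loop b.+2 body) (Loop b.+1 (Head _ _ MoveLeft)))), 2.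
move=> w rho M o [h1 h2 h3 h4].
have hB : (size w).+1 <= M ^ 2.
  by rewrite -mulnn; apply: leq_trans (_ : 2 * M <= _); [lia|rewrite leq_mul2r h1 orbT].
move: (M ^ 2) hB => B hB; set n := (size w).+1 in hB *.
pose st i v := upd (upd (upd rho b i) b.+1 i) b.+2 v.
have scan d i : i + d = n -> exec w B (Loop b.+2 body) (Store (st i 1) i o)
    (Store (st n 0) n o).
  elim: d i => [|d IHd] i hd.
    rewrite addn0 in hd; rewrite {}hd; apply: (@ExLoopS _ _ _ _ _ _ _ _ _ 0).
    - exact: updE.
    - apply: ExIf; rewrite /= onth_default //; apply: ExSkip.
    - have -> : upd (st n 1) b.+2 0 = st n 0 by rewrite /st; upd_eq.
      by apply: ExLoop0; rewrite /st updE.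
  apply: (@ExLoopS _ _ _ _ _ _ _ _ _ 0 (Store (st i.+1 1) i.+1 o)); last 1 first.
  - by apply: IHd; lia.
  - exact: updE.
  have inside : (if icell_at w i is RightEnd then true else false) = false.
    case: i hd => //= i hd; case e: (onth w i) => //.
    by have := onthTE w i; rewrite e /=; lia.
  apply: ExIf; rewrite inside.
  apply: ExSeq; first exact: ExHead.
  have -> : minn (Defs.shift MoveRight i) (size w).+1 = i.+1 by rewrite /=; lia.
  have e1 : upd (st i 1) b.+2 0 b = i by
    rewrite /st /upd; repeat (case: (_ =P _) => ?); lia.
  have e2 : upd (st i 1) b.+2 0 b.+1 = i by
    rewrite /st /upd; repeat (case: (_ =P _) => ?); lia.
  apply: ExSeq; first by apply: ExInc; rewrite e1; lia.
  apply: ExSeq; first by apply: ExInc;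
    rewrite /upd; repeat (case: (_ =P _) => ?); rewrite ?e2 /st /upd;
      repeat (case: (_ =P _) => ?); lia.
  set rho1 := upd _ b.+1 _.
  have e3 : rho1 b.+2 = 0 by
    rewrite /rho1 /upd; repeat (case: (_ =P _) => ?); lia.
  have -> : st i.+1 1 = upd rho1 b.+2 (rho1 b.+2).+1 by
    rewrite e3 /rho1 /st; upd_eq.
  by apply: ExInc; rewrite e3; lia.
apply: ExSeq.
  by apply: ExInc; rewrite h4; lia.
apply: ExSeq.
  rewrite h4; last lia.
  have -> : upd rho b.+2 1 = st 0 1 by rewrite /st; upd_eq; rewrite ?h4 //; lia.
  exact: scan.
apply: (@exec_loop _ _ _ _ _ _ n (fun i =>
  Store (upd (upd (upd rho b n) b.+1 (n - i)) b.+2 0) (n - i) o)) => /=.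
- by move=> i _; rewrite /upd; repeat (case: (_ =P _) => ?); lia.
- move=> i hi; have -> : n - i.+1 = minn (Defs.shift MoveLeft (n - i)) (size w).+1.
    by rewrite /=; lia.
  set v := minn _ _; have -> : upd (upd (upd rho b n) b.+1 v) b.+2 0 =
    upd (upd (upd (upd rho b n) b.+1 (n - i)) b.+2 0) b.+1 v by upd_eq.
  exact: ExHead.
- by rewrite subn0.
- by rewrite subnn; congr Store; upd_eq; rewrite ?h4 //; lia.
Qed.

Lemma LS_size : LS (fun w _ => size w).
Proof. exact: LS_pred LS_size_succ. Qed.

(** A conditional on a computed value is a loop of zero or one round. *)
Lemma LSO_if (P : seq Sin -> seq nat -> bool) X Y :
  LS (fun w e => nat_of_bool (P w e)) -> LSO X -> LSO Y ->
  LSO (fun w e => if P w e then X w e else Y w e).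
Proof.
move=> hP hX hY.
have h1 := LSO_for (P := fun w e _ => X w e) hP (LSO_wk hX).
have h2 := LSO_for (P := fun w e _ => Y w e) (LS_not hP) (LSO_wk hY).
apply: (LSO_ext _ (LSO_cat h1 h2)) => w e.
by case: (P w e); rewrite /= !cats0.
Qed.

End Arithmetic.

(** * Binary integers of polynomial length *)

Import Order.TTheory GRing.Theory Num.Theory.

Definition msb_val (s : seq bool) : nat :=
  foldl (fun k (x : bool) => (k.*2 + x)%N) 0%N s.

Section Carry.
Variables (f g : nat -> nat) (N : nat).

Definition offset : nat := \sum_(0 <= j < N) g j.

Definition digit_sum (h : nat -> nat) (k : nat) : nat :=
  \sum_(0 <= j < k) (j < N) * h j * 2 ^ j.

(** With true carry [x - offset], the next one is the floor of half of [x - offset + f j - g j];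
    putting [offset] back under the halving adds twice [offset], which gives this expression. The
    subtraction is exact because [g j <= offset] for [j < N]. *)
Definition carry_in (x j : nat) : nat := x + offset + (j < N) * f j - (j < N) * g j.

(* The carries of the signed digits [f j - g j], shifted by [offset] to make
   them nonnegative. *)
Definition carry (k : nat) : nat :=
  iteri k (fun j x => (carry_in x j)./2) offset.

Definition digit (k : nat) : bool := odd (carry_in (carry k) k).

Lemma mask_le_sum (h : nat -> nat) j :
  (j < N) * h j <= \sum_(0 <= i < N) h i.
Proof.
case: ltnP => hj; last by rewrite mul0n.
rewrite mul1n (big_cat_nat (n := j)) //= ?(ltnW hj) //.
by rewrite (big_ltn hj); lia.
Qed.

(** The new carry is at most the mean of the bound and [offset + f k], and the latter does not
    exceed the bound either. *)
Lemma carry_le k : carry k <= offset + \sum_(0 <= j < N) f j.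
Proof.
elim: k => [|k IHk]; rewrite /carry /=; first by rewrite leq_addr.
rewrite -/(carry k) /carry_in; have := mask_le_sum f k.
move: (carry k) IHk => x; lia.
Qed.

Definition bit_sum (k : nat) : nat := \sum_(0 <= j < k) digit j * 2 ^ j.

Lemma bit_sum_lt k : bit_sum k < 2 ^ k.
Proof.
elim: k => [|k IHk]; rewrite /bit_sum ?big_nil // big_nat_recr //= -/(bit_sum k).
by rewrite expnS; case: digit; lia.
Qed.

(** In signed terms, the first [k] digits have the value [bit_sum k + 2 ^ k (carry k - offset)]; the
    offsets are moved across to stay in [nat]. *)
Lemma carry_invariant k :
  digit_sum f k + 2 ^ k * offset = digit_sum g k + bit_sum k + 2 ^ k * carry k.
Proof.
elim: k => [|k IHk].
  by rewrite /digit_sum /bit_sum !big_nil /carry /=; lia.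
rewrite /digit_sum /bit_sum !big_nat_recr //= -/(digit_sum f k) -/(digit_sum g k).
rewrite -/(bit_sum k) /carry /= -/(carry k) expnS.
have h : (carry_in (carry k) k)./2 * 2 + digit k + (k < N) * g k =
         carry k + offset + (k < N) * f k.
  rewrite /digit; have := odd_double_half (carry_in (carry k) k).
  have := mask_le_sum g k; rewrite -/offset /carry_in.
  by move: (odd _) (_./2) => b x; lia.
move: (2 ^ k) IHk => A IHk.
have h2 : A * ((carry_in (carry k) k)./2 * 2 + digit k + (k < N) * g k) =
         A * (carry k + offset + (k < N) * f k) by rewrite h.
move: h2; rewrite !mulnDr.
move: (_./2) (nat_of_bool (digit k)) (_ * g k) (_ * f k) => x d gk fk.
rewrite !(mulnC _ A) => ?; nia.
Qed.

Lemma digit_sum_ge h k : N <= k -> digit_sum h k = digit_sum h N.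
Proof.
move=> hk; rewrite /digit_sum (big_cat_nat (n := N)) //= [X in _ + X]big_nat_cond.
rewrite [X in _ + X]big1 ?addn0 // => i /andP[/andP[hi _] _].
by rewrite ltnNge hi.
Qed.

(** As [bit_sum N < 2 ^ N], the value has the sign of the true carry [carry N - offset]. *)
Lemma carry_sign : (digit_sum g N <= digit_sum f N) = (offset <= carry N).
Proof.
have := carry_invariant N; have := bit_sum_lt N.
move: (2 ^ N) (bit_sum N) (carry N) => A b c hb e.
case: (leqP offset c) => h.
  have : A * offset <= A * c by rewrite leq_mul2l h orbT.
  by move=> ?; apply/idP; lia.
have : A * c.+1 <= A * offset by rewrite leq_mul2l h orbT.
by rewrite mulnS => ?; apply/negbTE; rewrite -ltnNge; lia.
Qed.

(** A crude but polynomial length: the value is below [2 ^ N (carry N + 1)], hence below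
    [2 ^ (N + carry N)]. *)
Definition width : nat := N + carry N.

Lemma bit_sumE : digit_sum g N <= digit_sum f N ->
  digit_sum f N = digit_sum g N + bit_sum width.
Proof.
move=> h0.
have h1 := carry_invariant N; have h2 := carry_invariant width.
have hw : N <= width by rewrite leq_addr.
rewrite !digit_sum_ge // in h2.
have b1 := bit_sum_lt N; have b2 := bit_sum_lt width.
have hlt : digit_sum f N < digit_sum g N + 2 ^ width.
  have hc : carry N < 2 ^ carry N by apply: ltn_expl.
  have : 2 ^ N * (carry N).+1 <= 2 ^ width by rewrite expnD leq_mul2l hc orbT.
  rewrite mulnS; lia.
(* A positive true carry would make the value at least [2 ^ width], a negative one would make it
   negative; so it is 0 and the bits are the whole value. *)
have [h|h|h] := ltngtP offset (carry width).
- have : 2 ^ width * offset.+1 <= 2 ^ width * carry width by rewrite leq_mul2l h orbT.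
  rewrite mulnS; lia.
- have : 2 ^ width * (carry width).+1 <= 2 ^ width * offset by rewrite leq_mul2l h orbT.
  rewrite mulnS; lia.
- rewrite h in h2; lia.
Qed.

Definition bits : seq bool := [seq digit (width - i.+1) | i <- iota 0 width].

Lemma msb_val_bits : msb_val bits = bit_sum width.
Proof.
rewrite /msb_val /bits; suff H n a :
    foldl (fun k (x : bool) => k.*2 + x) a [seq digit (n - i.+1) | i <- iota 0 n] =
    a * 2 ^ n + bit_sum n by rewrite H.
elim: n a => [|n IHn] a; first by rewrite /bit_sum big_nil muln1 addn0.
rewrite /= subn1 /= (iotaDl 1 0) -map_comp.
under eq_map => i do rewrite /= add1n subSS.
rewrite IHn /bit_sum big_nat_recr //= expnS.
by move: (digit n : nat) (2 ^ n) => d A; lia.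
Qed.

End Carry.

Section BigNumbers.
Variables (Sin Sout : finType).
Notation LS := (@LS Sin Sout).
Notation LSO := (@LSO Sin Sout).
Local Open Scope ring_scope.

Definition LS1 (F : seq Sin -> seq nat -> nat -> nat) : Prop :=
  LS (fun w e => F w (behead e) (head 0%N e)).

(* [Z] is an integer of polynomial length: the value at 2 of a polynomial whose
   coefficients are differences of numbers computable in logarithmic space. *)
Definition BN (Z : seq Sin -> seq nat -> int) : Prop :=
  exists (p : seq Sin -> seq nat -> {poly int})
         (F G : seq Sin -> seq nat -> nat -> nat) (K : nat),
    [/\ LS1 F, LS1 G,
        forall w e k, (p w e)`_k = (F w e k)%:Z - (G w e k)%:Z,
        forall w e, (size (p w e) <= K * (size w).+1)%N
      & forall w e, (p w e).[2] = Z w e].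

Lemma BN_ext Z Y : (forall w e, Z w e = Y w e) -> BN Z -> BN Y.
Proof. by move=> h; have -> : Z = Y by apply/funext => w; apply/funext. Qed.

Lemma BN_nat F : LS F -> BN (fun w e => (F w e)%:Z).
Proof.
move=> hF; exists (fun w e => ((F w e)%:Z)%:P), (fun w e k => (F w e * (k == 0%N))%N),
  (fun _ _ _ => 0%N), 1%N; split.
- apply: LS_mul; first exact: (LS_wk_iter 1 hF).
  apply: LS_eq0; exact: LS_head.
- exact: LS_const.
- by move=> w e k; rewrite coefC subr0; case: eqP => _; rewrite ?muln1 ?muln0.
- by move=> w e; rewrite size_polyC; case: (_ != 0); lia.
- by move=> w e; rewrite hornerC.
Qed.

Lemma BN_add Z Y : BN Z -> BN Y -> BN (fun w e => Z w e + Y w e).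
Proof.
case=> p [F [G [K [hF hG hp hs hv]]]] [q [F' [G' [K' [hF' hG' hp' hs' hv']]]]].
exists (fun w e => p w e + q w e), (fun w e k => (F w e k + F' w e k)%N),
  (fun w e k => (G w e k + G' w e k)%N), (K + K')%N; split.
- exact: LS_add hF hF'.
- exact: LS_add hG hG'.
- by move=> w e k; rewrite coefD hp hp' !PoszD; ring.
- move=> w e; apply: leq_trans (size_polyD _ _) _.
  by rewrite geq_max; have := hs w e; have := hs' w e; nia.
- by move=> w e; rewrite hornerD hv hv'.
Qed.

Lemma BN_opp Z : BN Z -> BN (fun w e => - Z w e).
Proof.
case=> p [F [G [K [hF hG hp hs hv]]]]; exists (fun w e => - p w e), G, F, K.
split=> // w e; rewrite ?size_polyN ?hornerN ?hv //.
by move=> k; rewrite coefN hp opprB.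
Qed.

Lemma BN_sub Z Y : BN Z -> BN Y -> BN (fun w e => Z w e - Y w e).
Proof. by move=> hZ hY; apply: BN_add => //; apply: BN_opp. Qed.

Lemma LS1_convol F G : LS1 F -> LS1 G ->
  LS1 (fun w e k => \sum_(0 <= j < k.+1) F w e j * G w e (k - j))%N.
Proof.
move=> hF hG; apply: LS_sum; first exact/LS_succ/LS_head.
apply: LS_mul; first exact: (@LS_app _ _ 2 F _ hF (LS_head _ _)).
apply: (@LS_app _ _ 2 G _ hG); apply: LS_sub; [exact: LS_var1|exact: LS_head].
Qed.

(** Products of polynomials are convolutions, with signs separated by [(F - G) (F' - G') = (F F' + G
    G') - (F G' + G F')]. *)
Lemma BN_mul Z Y : BN Z -> BN Y -> BN (fun w e => Z w e * Y w e).
Proof.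
case=> p [F [G [K [hF hG hp hs hv]]]] [q [F' [G' [K' [hF' hG' hp' hs' hv']]]]].
exists (fun w e => p w e * q w e),
  (fun w e k => \sum_(0 <= j < k.+1) F w e j * F' w e (k - j) +
                \sum_(0 <= j < k.+1) G w e j * G' w e (k - j))%N,
  (fun w e k => \sum_(0 <= j < k.+1) F w e j * G' w e (k - j) +
                \sum_(0 <= j < k.+1) G w e j * F' w e (k - j))%N, (K + K')%N; split.
- by apply: LS_add; apply: LS1_convol.
- by apply: LS_add; apply: LS1_convol.
- move=> w e k; rewrite coefM !PoszD !big_mkord.
  rewrite !(big_morph Posz PoszD (erefl _)) -!big_split -sumrB.
  by apply: eq_bigr => j _; rewrite hp hp' !PoszM; ring.
- move=> w e; apply: leq_trans (size_polyMleq _ _) _.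
  by have := hs w e; have := hs' w e; nia.
- by move=> w e; rewrite hornerM hv hv'.
Qed.

Lemma BN_if (P : seq Sin -> seq nat -> bool) Z Y :
  LS (fun w e => nat_of_bool (P w e)) -> BN Z -> BN Y ->
  BN (fun w e => if P w e then Z w e else Y w e).
Proof.
move=> hP hZ hY; apply: (BN_ext _ (BN_add (BN_mul (BN_nat hP) hZ)
  (BN_mul (BN_nat (LS_not hP)) hY))) => w e.
by case: (P w e); rewrite /=; ring.
Qed.

Section Digits.
Variables (F G : seq Sin -> seq nat -> nat -> nat) (N : seq Sin -> seq nat -> nat).
Hypotheses (hF : LS1 F) (hG : LS1 G) (hN : LS N).

Lemma LS_offset : LS (fun w e => offset (G w e) (N w e)).
Proof. exact: LS_sum. Qed.

Lemma LS1_carry : LS1 (fun w e => carry (F w e) (G w e) (N w e)).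
Proof.
have hO k := @LS_wk_iter _ _ k _ LS_offset.
have hNk k := @LS_wk_iter _ _ k _ hN.
apply: (LS_rec (C := fun w e => offset (G w (behead e)) (N w (behead e)) +
   \sum_(0 <= j < N w (behead e)) F w (behead e) j)%N (LS_head _ _) (hO 1%N)).
- apply: LS_half; apply: LS_sub; [apply: LS_add; [apply: LS_add|]|].
  + exact: LS_var1.
  + exact: (hO 3%N).
  + apply: LS_mul; first by apply: LS_ltn; [exact: LS_head|exact: (hNk 3%N)].
    exact: (@LS_app _ _ 3 F _ hF (LS_head _ _)).
  + apply: LS_mul; first by apply: LS_ltn; [exact: LS_head|exact: (hNk 3%N)].
    exact: (@LS_app _ _ 3 G _ hG (LS_head _ _)).
- apply: (@LS_polyb _ Sout).
  exact: (LS_wk_iter 1 (LS_add LS_offset (LS_sum hN hF))).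
- by move=> w e i _; apply: carry_le.
Qed.

Lemma LS1_digit : LS1 (fun w e k => nat_of_bool (digit (F w e) (G w e) (N w e) k)).
Proof.
have hO := @LS_wk_iter _ _ 1 _ LS_offset.
have hN1 := @LS_wk_iter _ _ 1 _ hN.
have hlt : LS (fun w e => nat_of_bool (head 0 e < N w (behead e)))%N.
  by apply: LS_ltn; [exact: LS_head|exact: hN1].
apply: LS_odd; apply: LS_sub; first apply: LS_add; first apply: LS_add.
- exact: LS1_carry.
- exact: hO.
- exact: LS_mul.
- exact: LS_mul.
Qed.

Lemma LS_width : LS (fun w e => width (F w e) (G w e) (N w e)).
Proof. by apply: LS_add => //; apply: (@LS_app _ _ 0 _ _ LS1_carry hN). Qed.

Lemma LSO_bits (h : bool -> Sout) :
  LSO (fun w e => map h (bits (F w e) (G w e) (N w e))).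
Proof.
pose d w e k := digit (F w e) (G w e) (N w e) k.
pose W w e := width (F w e) (G w e) (N w e).
have hd : LS (fun w e => nat_of_bool
    (d w (behead e) (W w (behead e) - (head 0%N e).+1)%N)).
  apply: (@LS_app _ _ 1 (fun w e k => nat_of_bool (d w e k)) _ LS1_digit).
  apply: LS_sub; last exact/LS_succ/LS_head.
  exact: (LS_wk_iter 1 LS_width).
have := LSO_for (P := fun w e i => if d w e (W w e - i.+1)%N then [:: h true]
   else [:: h false]) LS_width (LSO_if hd (LSO_emit _ _) (LSO_emit _ _)).
apply: LSO_ext => w e; rewrite /bits -map_comp -[in RHS]flatten_map1.
by congr flatten; apply: eq_map => i; rewrite /d /W /comp; case: digit.
Qed.

End Digits.

Lemma BN_digits Z : BN Z -> exists F G N, [/\ LS1 F, LS1 G, LS N,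
  forall w e, (0 < N w e)%N &
  forall w e, Z w e = (digit_sum (N w e) (F w e) (N w e))%:Z -
                      (digit_sum (N w e) (G w e) (N w e))%:Z].
Proof.
case=> p [F [G [K [hF hG hp hs hv]]]].
(* [K.+1] instead of [K] makes the number of digits positive, so that even 0 is printed as a
   nonempty numeral. *)
exists F, G, (fun w e => K.+1 * (size w).+1)%N; split=> //.
  exact: LS_mul (LS_const _ _ _) (LS_succ (LS_size _ _)).
move=> w e; rewrite -hv (@horner_coef_wide _ (K.+1 * (size w).+1)%N); last first.
  by apply: leq_trans (hs w e) _; rewrite leq_mul2r leqnSn orbT.
rewrite /digit_sum !big_mkord !(big_morph Posz PoszD (erefl _)) -sumrB.
by apply: eq_bigr => i _; rewrite hp ltn_ord !mul1n !PoszM -[Posz (2 ^ i)]natz natrX;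
  ring.
Qed.

Lemma LS_ge0 Z : BN Z -> LS (fun w e => nat_of_bool (0 <= Z w e)).
Proof.
case/BN_digits=> F [G [N [hF hG hN _ hZ]]].
have := LS_leq (LS_offset hG hN) (@LS_app _ _ 0 _ _ (LS1_carry hF hG hN) hN).
by apply: LS_ext => w e; rewrite hZ subr_ge0 lez_nat carry_sign.
Qed.

Lemma LS_lez Z Y : BN Z -> BN Y -> LS (fun w e => nat_of_bool (Z w e <= Y w e)).
Proof.
move=> hZ hY; apply: LS_ext (LS_ge0 (BN_sub hY hZ)) => w e.
by rewrite subr_ge0.
Qed.

Lemma LS_ltz Z Y : BN Z -> BN Y -> LS (fun w e => nat_of_bool (Z w e < Y w e)).
Proof.
move=> hZ hY; apply: LS_ext (LS_not (LS_lez hY hZ)) => w e.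
by rewrite -ltNge.
Qed.

Lemma LS_eqz Z Y : BN Z -> BN Y -> LS (fun w e => nat_of_bool (Z w e == Y w e)).
Proof.
move=> hZ hY; apply: LS_ext (LS_and (LS_lez hZ hY) (LS_lez hY hZ)) => w e.
by rewrite eq_le.
Qed.

Lemma LSO_binary (h : bool -> Sout) Z : BN Z ->
  exists bs : seq Sin -> seq nat -> seq bool,
    LSO (fun w e => map h (bs w e)) /\
    forall w e, 0 <= Z w e -> bs w e != [::] /\ (msb_val (bs w e))%:Z = Z w e.
Proof.
case/BN_digits=> F [G [N [hF hG hN hN0 hZ]]].
exists (fun w e => bits (F w e) (G w e) (N w e)); split; first exact: LSO_bits.
move=> w e; rewrite hZ subr_ge0 lez_nat => hle; split.
  by rewrite -size_eq0 size_map size_iota -lt0n addn_gt0 hN0.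
by rewrite msb_val_bits (bit_sumE hle) PoszD; ring.
Qed.

End BigNumbers.

(** * Reading the input *)

(** As [Slash] is a delimiter, a rational is two consecutive tokens, and each field of a system is
    found at a fixed token number. *)
Definition is_delim (s : symbol) : bool :=
  match s with Comma | Semicolon | Slash => true | _ => false end.
Definition is_bit (s : symbol) : bool := if s is Bit _ then true else false.
Definition is_one (s : symbol) : bool := if s is Bit b then b else false.
Definition is_minus (s : symbol) : bool := if s is Minus then true else false.
Definition bit_of (s : symbol) : option bool := if s is Bit b then Some b else None.

Fixpoint toks (w : word) : seq word :=
  if w is a :: w' then
    if is_delim a then [::] :: toks w'
    else if toks w' is t :: ts then (a :: t) :: ts else [:: [:: a]]
  else [:: [::]].

Definition word_val (u : word) : nat := msb_val (pmap bit_of u).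
Definition tok_val (w : word) (t : nat) : nat := word_val (nth [::] (toks w) t).
Definition tok_neg (w : word) (t : nat) : bool := has is_minus (nth [::] (toks w) t).

Definition letter_at (P : pred symbol) (w : word) (p : nat) : bool :=
  if onth w p is Some a then P a else false.

(** The number of the token to which position [p] belongs. *)
Definition delims (w : word) (p : nat) : nat :=
  \sum_(0 <= q < p) letter_at is_delim w q.

Definition tok_bits (w : word) (t : nat) : nat :=
  \sum_(0 <= q < size w) (delims w q == t) && letter_at is_bit w q.

(** For a bit of token [t] at position [p], this is its exponent: the number of bits of the token to
    its right. *)
Definition bit_rank (w : word) (t p : nat) : nat :=
  \sum_(0 <= q < size w) [&& p < q, delims w q == t & letter_at is_bit w q].

Definition tok_ones (w : word) (t p : nat) : bool :=
  (delims w p == t) && letter_at is_one w p.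

Lemma toks_cons w : exists t ts, toks w = t :: ts.
Proof.
by case: w => [|a w] /=; [|case: is_delim; [|case: (toks w)]]; do 2?eexists.
Qed.

Lemma delimsS a w p : delims (a :: w) p.+1 = is_delim a + delims w p.
Proof. by rewrite /delims big_nat_recl. Qed.

Lemma tok_bitsE w t : tok_bits w t = size (pmap bit_of (nth [::] (toks w) t)).
Proof.
elim: w t => [|a w IHw] t; first by rewrite /tok_bits big_nil; case: t => [|[]].
rewrite /tok_bits big_nat_recl // {1}/delims big_nil.
under eq_bigr => q _ do rewrite delimsS.
have [u [us e]] := toks_cons w; rewrite /= in IHw *.
case hd: (is_delim a) => /=.
  case: t => [|t] /=.
    have -> : letter_at is_bit (a :: w) 0 = false by case: a hd.
    by rewrite big1 // => q _; rewrite add1n.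
  rewrite add0n -IHw; apply: eq_bigr => q _; rewrite add1n eqSS //.
have -> : \sum_(0 <= q < size w) ((0 + delims w q == t) &&
     letter_at is_bit (a :: w) q.+1) = tok_bits w t by [].
rewrite IHw e; case: t => [|t] //=.
by rewrite /letter_at /=; case: a {hd}.
Qed.

Lemma msb_val_cons b s : msb_val (b :: s) = b * 2 ^ size s + msb_val s.
Proof.
rewrite /msb_val /=; set f := fun _ => _.
have H a : foldl f a s = a * 2 ^ size s + foldl f 0 s.
  elim: s a => [|c s IHs] a /=; first by rewrite muln1 addn0.
  by rewrite IHs (IHs (f 0 c)) /f expnS; move: (2 ^ _) (foldl _ _ _) => x y; lia.
exact: H.
Qed.

Lemma tok_valE w t : tok_val w t =
  \sum_(0 <= p < size w) tok_ones w t p * 2 ^ bit_rank w t p.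
Proof.
rewrite /tok_val /word_val; elim: w t => [|a w IHw] t.
  by rewrite big_nil; case: t => [|[]].
have rS p : bit_rank (a :: w) t p.+1 =
    \sum_(0 <= q < size w)
      [&& p < q, is_delim a + delims w q == t & letter_at is_bit w q].
  by rewrite /bit_rank big_nat_recl //; under eq_bigr => q _ do rewrite delimsS.
have r0 : bit_rank (a :: w) t 0 =
    \sum_(0 <= q < size w)
      (is_delim a + delims w q == t) && letter_at is_bit w q.
  by rewrite /bit_rank big_nat_recl //; under eq_bigr => q _ do rewrite delimsS.
rewrite big_nat_recl //; under eq_bigr => q _ do rewrite rS /tok_ones delimsS.
rewrite r0.
have [u [us e]] := toks_cons w; rewrite /= in IHw *.
rewrite /tok_ones {1}/delims big_nil.
case hd: (is_delim a) => /=.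
  have -> : letter_at is_one (a :: w) 0 = false by case: a hd {rS r0}.
  rewrite andbF mul0n add0n; case: t {rS r0} => [|t] /=.
    by rewrite big1 // => q _; rewrite add1n.
  by rewrite IHw.
rewrite -/(tok_bits w t) tok_bitsE -[X in _ = _ + X]IHw e; case: t {rS r0} => [|t] //=.
rewrite {1}/letter_at /=; case: a hd => //= b _.
by rewrite msb_val_cons.
Qed.

Lemma tok_negE w t : tok_neg w t =
  has (fun p => (delims w p == t) && letter_at is_minus w p) (iota 0 (size w)).
Proof.
rewrite /tok_neg; elim: w t => [|a w IHw] t; first by case: t => [|[]].
have [u [us e]] := toks_cons w; rewrite /= in IHw *.
rewrite (iotaDl 1 0) has_map {1}/delims big_nil.
rewrite (eq_has (a2 := fun p => (is_delim a + delims w p == t) &&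
  letter_at is_minus w p)); last by move=> p; rewrite /= delimsS.
case hd: (is_delim a) => /=.
  have -> : letter_at is_minus (a :: w) 0 = false by case: a hd.
  rewrite andbF /=; case: t => [|t] /=; last by rewrite IHw.
  by rewrite has_pred0.
by rewrite -IHw e; case: t => [|t].
Qed.

Lemma size_toks w : size (toks w) = (delims w (size w)).+1.
Proof.
elim: w => [|a w IHw]; first by rewrite /delims big_nil.
have [u [us e]] := toks_cons w; rewrite /= delimsS -addnS -IHw.
by case: is_delim; rewrite ?e.
Qed.

Section TokensComputable.
Notation LS := (@LS symbol symbol).
Notation BN := (@BN symbol symbol).
Implicit Types t p : word -> seq nat -> nat.

Lemma LS_letter_at P p : LS p ->
  LS (fun w e => nat_of_bool (letter_at P w (p w e))).
Proof.
move=> hp; have := LS_cell (fun x => if x is Letter a then P a else false) (LS_succ hp).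
by apply: LS_ext => w e; rewrite /letter_at /=; case: onth.
Qed.

Lemma LS_delims p : LS p -> LS (fun w e => delims w (p w e)).
Proof. by move=> hp; apply: LS_sum => //; apply: LS_letter_at; apply: LS_head. Qed.

Lemma LS_tok_neg t : LS t -> LS (fun w e => nat_of_bool (tok_neg w (t w e))).
Proof.
move=> ht; apply: (LS_ext (fun w e => congr1 nat_of_bool (esym (tok_negE w (t w e))))).
apply: LS_has; first exact: LS_size.
apply: LS_and; last by apply: LS_letter_at; apply: LS_head.
apply: LS_eqn; [exact/LS_delims/LS_head|exact: (LS_wk_iter 1 ht)].
Qed.

Lemma LS_size_toks : LS (fun w _ => size (toks w)).
Proof.
apply: (LS_ext (fun w _ => esym (size_toks w))).
exact/LS_succ/LS_delims/LS_size.
Qed.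

Lemma LS_bit_rank t p : LS t -> LS p -> LS (fun w e => bit_rank w (t w e) (p w e)).
Proof.
move=> ht hp; apply: LS_sum; first exact: LS_size.
apply: LS_and; first by apply: LS_ltn; [exact: (LS_wk_iter 1 hp)|exact: LS_head].
apply: LS_and; last by apply: LS_letter_at; apply: LS_head.
apply: LS_eqn; [exact/LS_delims/LS_head|exact: (LS_wk_iter 1 ht)].
Qed.

Lemma LS_tok_ones t p : LS t -> LS p ->
  LS (fun w e => nat_of_bool (tok_ones w (t w e) (p w e))).
Proof.
move=> ht hp; apply: LS_and; last exact: LS_letter_at.
by apply: LS_eqn => //; apply: LS_delims.
Qed.

Local Open Scope ring_scope.

Lemma bit_rank_le (w : word) (t p : nat) : (bit_rank w t p <= size w)%N.
Proof.
apply: (@leq_trans (\sum_(0 <= q < size w) 1)%N); last first.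
  by rewrite sum_nat_const_nat subn0 muln1.
by apply: leq_sum => q _; case: (_ && _).
Qed.

(** The coefficient at [2 ^ k] counts the ones of rank [k] in the token. Ranks are at most [size w],
    so cutting off at [(size w).+1] coefficients loses nothing. *)
Lemma BN_tok_val t : LS t -> BN (fun w e => (tok_val w (t w e))%:Z).
Proof.
move=> ht.
pose F w e k := (\sum_(0 <= p < size w) tok_ones w (t w e) p *
                   (bit_rank w (t w e) p == k))%N.
pose M w e k := ((k < (size w).+1) * F w e k)%N.
have hM : LS1 symbol M.
  apply: LS_mul.
    by apply: LS_ltn; [exact: LS_head|exact/LS_succ/LS_size].
  apply: LS_sum; first exact: LS_size.
  have ht2 := LS_wk_iter 2 ht.
  apply: LS_mul; first exact: LS_tok_ones ht2 (LS_head _ _).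
  apply: LS_eqn; last exact: LS_var1.
  exact: LS_bit_rank ht2 (LS_head _ _).
exists (fun w e => \poly_(k < (size w).+1) (M w e k)%:Z), M, (fun _ _ _ => 0%N), 1%N.
split=> //.
- exact: LS_const.
- by move=> w e k; rewrite coef_poly subr0 /M; case: ltnP => _; rewrite ?mul0n.
- by move=> w e; rewrite mul1n; apply: size_poly.
- move=> w e; rewrite horner_poly tok_valE.
  rewrite (big_morph Posz PoszD (erefl _)).
  under [LHS]eq_bigr => k _ do rewrite /M ltn_ord mul1n /F (big_morph Posz PoszD
    (erefl _)) mulr_suml.
  rewrite exchange_big /=; apply: eq_bigr => p _.
  have hr : (bit_rank w (t w e) p < (size w).+1)%N by rewrite ltnS bit_rank_le.
  rewrite (bigD1 (Ordinal hr)) //= eqxx big1.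
    by rewrite muln1 addr0 PoszM -[Posz (2 ^ _)]natz natrX.
  move=> k hk; suff -> : (bit_rank w (t w e) p == k) = false by rewrite muln0 mul0r.
  by apply/eqP => h; move/eqP: hk; apply; apply/val_inj.
Qed.

End TokensComputable.

Lemma toks_cat u d v : is_delim d -> toks (u ++ d :: v) = toks u ++ toks v.
Proof.
move=> hd; elim: u => [|a u IHu] /=; first by rewrite hd.
rewrite IHu; case: is_delim => //.
by have [t [ts ->]] := toks_cons u.
Qed.

Lemma toks_nodelim w : all (predC is_delim) w -> toks w = [:: w].
Proof. by elim: w => //= a w IHw /andP[/negbTE-> /IHw->]. Qed.

Lemma nat_code_nodelim n w : nat_code n w ->
  [/\ all (predC is_delim) w, has is_minus w = false & word_val w = n].
Proof.
case=> b [_ hn ->]; split.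
- by apply/allP => x /mapP[y _ ->].
- by apply/hasPn => x /mapP[y _ ->].
- rewrite /word_val /msb_val -hn; congr foldl.
  by elim: b {hn} => //= x b ->.
Qed.

Local Open Scope ring_scope.

Definition field_val (r : rat) (u v : word) : Prop :=
  (0 < word_val v)%N /\
  r = (-1) ^+ has is_minus u * ((word_val u)%:R / (word_val v)%:R).

Lemma rat_code_toks r w : rat_code r w ->
  exists u v, toks w = [:: u; v] /\ field_val r u v.
Proof.
case=> s [p [q [wp [wq [hp hq q0 -> ->]]]]].
have [np mp vp] := nat_code_nodelim hp; have [nq mq vq] := nat_code_nodelim hq.
exists (nseq s Minus ++ wp), wq; split.
  rewrite catA toks_cat // toks_nodelim ?toks_nodelim //.
  by rewrite all_cat np andbT; case: s.
rewrite /field_val vq has_cat mp orbF; split=> //; congr (_ ^+ _ * (_%:R / _)).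
  by case: s.
by rewrite -vp /word_val pmap_cat; case: s.
Qed.

Lemma flatten_toks (I : Type) (w : word) (g : I -> word) (l : seq I) :
  toks (w ++ flatten [seq Semicolon :: g m | m <- l]) =
  toks w ++ flatten [seq toks (g m) | m <- l].
Proof.
elim: l w => [|m l IHl] w /=; first by rewrite !cats0.
by rewrite toks_cat // IHl.
Qed.

Lemma nth_flatten_const (T : Type) (x0 : T) n (ss : seq (seq T)) i j :
  all (fun s => size s == n) ss -> (j < n)%N -> (i < size ss)%N ->
  nth x0 (flatten ss) (n * i + j) = nth x0 (nth [::] ss i) j.
Proof.
elim: ss i => // s ss IHs i /= /andP[/eqP hs hss] hj hi.
case: i hi => [|i] hi; rewrite nth_cat hs.
  by rewrite muln0 add0n hj.
by rewrite mulnS -addnA ltnNge leq_addr /= addKn IHs.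
Qed.

Definition tok_field (w : word) (r : rat) (t : nat) : Prop :=
  (0 < tok_val w t.+1)%N /\
  r = (-1) ^+ tok_neg w t * ((tok_val w t)%:R / (tok_val w t.+1)%:R).

Lemma system_code_toks S w : system_code S w ->
  [/\ size (toks w) = (6 + 6 * #|mode S|)%N,
      tok_field w (vmin S) 0, tok_field w (vmax S) 2, tok_field w (v0 S) 4
    & forall m : mode S, let t := (6 + 6 * enum_rank m)%N in
      [/\ tok_field w (rate m) t, tok_field w (cost_c m) t.+2
        & tok_field w (cost_d m) t.+4]].
Proof.
case=> w1 [w2 [w3 [f [h1 h2 h3 hf ->]]]].
have [u1 [v1 [e1 f1]]] := rat_code_toks h1.
have [u2 [v2 [e2 f2]]] := rat_code_toks h2.
have [u3 [v3 [e3 f3]]] := rat_code_toks h3.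
have hg m : exists g, [/\ f m = Semicolon :: g, size (toks g) = 6
    & exists ur vr uc vc ud vd, [/\ toks g = [:: ur; vr; uc; vc; ud; vd],
       field_val (rate m) ur vr, field_val (cost_c m) uc vc
       & field_val (cost_d m) ud vd]].
  have [wr [wc [wd [hr hc hd hfm]]]] := hf m; rewrite hfm.
  have [ur [vr [er fr]]] := rat_code_toks hr.
  have [uc [vc [ec fc]]] := rat_code_toks hc.
  have [ud [vd [ed fd]]] := rat_code_toks hd.
  have e : toks (wr ++ Comma :: wc ++ Comma :: wd) = [:: ur; vr; uc; vc; ud; vd].
    by rewrite !toks_cat // er ec ed.
  eexists; split; [by []|by rewrite e|].
  by exists ur, vr, uc, vc, ud, vd.
pose g m := behead (f m).
have ef m : f m = Semicolon :: g m by rewrite /g; have [x [-> _]] := hg m.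
have sg m : size (toks (g m)) = 6 by rewrite /g; have [x [-> ]] := hg m.
set W := _ ++ _.
have eW : toks W = [:: u1; v1; u2; v2; u3; v3] ++
    flatten [seq toks (g m) | m <- enum (mode S)].
  rewrite /W !toks_cat // e1 e2 (eq_map ef) flatten_toks e3 //.
have hss : all (fun s => size s == 6) [seq toks (g m) | m <- enum (mode S)].
  by apply/allP => _ /mapP[m _ ->]; rewrite sg.
split.
- rewrite eW size_cat size_flatten /shape cardE; congr (_ + _)%N.
  by elim: (enum _) => //= m l ->; rewrite sg mulnS.
- by rewrite /tok_field /tok_val /tok_neg eW.
- by rewrite /tok_field /tok_val /tok_neg eW.
- by rewrite /tok_field /tok_val /tok_neg eW.
move=> m t.
have ht j : (j < 6)%N -> nth [::] (toks W) (t + j) = nth [::] (toks (g m)) j.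
  move=> hj; rewrite eW /t -addnA [nth _ _ _]/= nth_flatten_const //; last first.
    by rewrite size_map -cardE ltn_ord.
  rewrite (nth_map m) -?cardE ?ltn_ord //.
  by rewrite -[X in nth m _ X]/(nat_of_ord (enum_rank m)) nth_enum_rank.
have [x [ex _ [ur [vr [uc [vc [ud [vd [eg a b c]]]]]]]]] := hg m.
have eg' : toks (g m) = [:: ur; vr; uc; vc; ud; vd] by rewrite /g ex.
have t0 := ht 0%N isT; have t1 := ht 1%N isT; have t2 := ht 2%N isT.
have t3 := ht 3%N isT; have t4 := ht 4%N isT; have t5 := ht 5%N isT.
rewrite eg' ?addn0 ?addn1 ?addn2 ?addn3 ?addn4 /= in t0 t1 t2 t3 t4 t5.
rewrite (_ : (t + 5)%N = t.+4.+1) in t5; last by rewrite !addnS addn0.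
by split; rewrite /tok_field /tok_val /tok_neg ?t0 ?t1 ?t2 ?t3 ?t4 ?t5.
Qed.

(** * Optimal schedules *)

Section Limits.
Variable R : realType.
Implicit Types (u t : nat -> R) (l : R).

Lemma limn_esup_ge u l :
  (forall e, 0 < e -> exists N, forall k, (N <= k)%N -> l - e <= u k) ->
  (l%:E <= limn_esup (fun k => (u k)%:E))%E.
Proof.
move=> h; rewrite limn_esup_lim; apply: lime_ge; first exact: is_cvg_esups.
apply: nearW => n; apply/lee_subgt0Pr => e e0; have [N hN] := h e e0.
rewrite -EFinB; apply: (@le_trans _ _ (u (maxn n N))%:E).
  by rewrite lee_fin; apply: hN; apply: leq_maxr.
apply: ereal_sup_ubound; exists (maxn n N) => //=; exact: leq_maxl.
Qed.

Lemma limn_esup_le u l :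
  (forall e, 0 < e -> exists N, forall k, (N <= k)%N -> u k <= l + e) ->
  (limn_esup (fun k => (u k)%:E) <= l%:E)%E.
Proof.
move=> h; rewrite limn_esup_lim; apply/lee_addgt0Pr => e e0.
have [N hN] := h e e0; rewrite -EFinD.
apply: lime_le; first exact: is_cvg_esups.
exists N => // n /= hn; apply: ge_ereal_sup => _ [k /= hk <-].
by rewrite lee_fin; apply: hN; apply: leq_trans hk.
Qed.

Lemma sum_pos_mono t m n : (forall i, 0 < t i) -> (m <= n)%N ->
  \sum_(i < m) t i <= \sum_(i < n) t i.
Proof.
move=> t0 hmn; rewrite -(subnKC hmn) big_split_ord /= lerDl.
by apply: sumr_ge0 => i _; apply: ltW.
Qed.

Lemma sum_pinfty_unbounded t : (forall i, 0 < t i) ->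
  (\sum_(0 <= i <oo) (t i)%:E = +oo)%E ->
  forall A : R, exists N, forall k, (N <= k)%N -> A <= \sum_(i < k) t i.
Proof.
move=> t0 hoo A; apply: contrapT => hN.
have hlt k : \sum_(i < k) t i <= A.
  rewrite leNgt; apply/negP => hk; apply: hN; exists k => n hn.
  by apply: le_trans (sum_pos_mono t0 hn); apply: ltW.
suff : (\sum_(0 <= i <oo) (t i)%:E <= A%:E)%E by rewrite hoo leNgt ltry.
apply: lime_le.
  by apply: is_cvg_nneseries => n _ _; rewrite lee_fin ltW.
by apply: nearW => n; rewrite big_mkord sumEFin lee_fin.
Qed.

Lemma sum_unbounded_pinfty t (tau : R) : 0 < tau -> (forall i, tau <= t i) ->
  (\sum_(0 <= i <oo) (t i)%:E = +oo)%E.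
Proof.
move=> tau0 ht; apply/eqyP => A A0.
have t0 i : 0 < t i by apply: lt_le_trans (ht i).
pose n := (Num.truncn (A / tau)).+1.
apply: (@le_trans _ _ (\sum_(0 <= i < n) (t i)%:E)%E); last first.
  by apply: nneseries_lim_ge => i _ _; rewrite lee_fin ltW.
rewrite big_mkord sumEFin lee_fin.
apply: (@le_trans _ _ (\sum_(i < n) tau)); last by apply: ler_sum.
rewrite sumr_const card_ord -mulr_natr mulrC -ler_pdivrMr //.
by rewrite /n; apply: ltW; rewrite truncnS_gt.
Qed.

End Limits.

(** * Lower bound on the cost of safe schedules *)

Section Potential.
Variable R : realType.

(* An action covering a part of the range costs at least the corresponding part
   of what covering the whole range costs, as the switching costs [d] are
   nonnegative; hence a single slope serves both directions. *)
Lemma slope_exists (M : finType) (r x d T : M -> R) (L : R) : 0 < L ->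
  (forall m, 0 <= d m) ->
  (forall m, r m != 0 -> 0 < T m /\ T m * `|r m| = L) ->
  (forall m, r m = 0 -> 0 <= x m) ->
  (forall i j, 0 < r i -> r j < 0 -> 0 <= d i + x i * T i + (d j + x j * T j)) ->
  exists s : R, forall m t, 0 <= t -> t * `|r m| <= L ->
    s * (t * r m) <= d m + x m * t.
Proof.
move=> L0 hd hT hz hp; pose h m := d m + x m * T m.
suff [s [s1 s2]] : exists s, (forall i, 0 < r i -> s * L <= h i) /\
                             (forall j, r j < 0 -> - s * L <= h j).
  exists s => m t t0 ht.
  have [r0|r0|r0] := ltgtP (r m) 0; last first.
  - by rewrite r0 !mulr0 addr_ge0 // mulr_ge0 // hz.
  - have [T0 eT] := hT m (lt0r_neq0 r0).
    have := s1 _ r0; rewrite /h -eT (gtr0_norm r0) in ht * => hs.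
    have htT : t <= T m by move: ht; rewrite ler_pM2r.
    (* After multiplication by [T m], the goal is the inequality for a full crossing scaled by [t],
       plus the nonnegative remainder [d m * (T m - t)] of the switching cost. *)
    rewrite -(ler_pM2r T0).
    have h1 : t * (s * (T m * r m)) <= t * (d m + x m * T m) by apply: ler_wpM2l.
    have h2 : 0 <= d m * (T m - t) by apply: mulr_ge0; rewrite ?hd // subr_ge0.
    by nra.
  - have [T0 eT] := hT m (ltr0_neq0 r0).
    have := s2 _ r0; rewrite /h -eT (ltr0_norm r0) in ht * => hs.
    have htT : t <= T m by move: ht; rewrite ler_pM2r // oppr_gt0.
    rewrite -(ler_pM2r T0).
    have h1 : t * (- s * (T m * - r m)) <= t * (d m + x m * T m) by apply: ler_wpM2l.
    have h2 : 0 <= d m * (T m - t) by apply: mulr_ge0; rewrite ?hd // subr_ge0.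
    by nra.
have L1 : L != 0 by apply: lt0r_neq0.
(* The largest slope that the ascending modes permit, given by their cheapest full crossing; the
   hypothesis on pairs then handles the descending modes. *)
case: (pickP (fun i => 0 < r i)) => [i0 hi0|npos].
  have [i hi hmin] := @arg_minP _ _ _ i0 (fun i => 0 < r i) h hi0.
  exists (h i / L); split=> [k hk|j hj]; first by rewrite mulfVK //; apply: hmin.
  by rewrite mulNr mulfVK //; have := hp i j hi hj; rewrite /h; lra.
case: (pickP (fun j => r j < 0)) => [j0 hj0|nneg].
  have [j hj hmin] := @arg_minP _ _ _ j0 (fun j => r j < 0) h hj0.
  exists (- (h j / L)); split=> [k hk|k hk]; first by rewrite npos in hk.
  by rewrite opprK mulfVK //; apply: hmin.
by exists 0; split=> k hk; [rewrite npos in hk|rewrite nneg in hk].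
Qed.

Variable S : system.
Implicit Types (a : nat -> mode S * R) (m : mode S).

Let V x : R := ratr x.
Let r m : R := ratr (rate m).
Let L : R := V (vmax S) - V (vmin S).

Definition full_time m : rat := (vmax S - vmin S) / `|rate m|.

(** Both modes cross the full range, since longer actions spread the switching costs over more
    time. *)
Definition cycle_cost (i j : mode S) : rat :=
  (cost_d i + cost_d j + (cost_c i * full_time i + cost_c j * full_time j)) /
  (full_time i + full_time j).

Lemma range_gt0 : 0 < L.
Proof. by rewrite subr_gt0 ltr_rat vmin_lt_vmax. Qed.

Lemma full_timeP m : r m != 0 ->
  0 < (ratr (full_time m) : R) /\ ratr (full_time m) * `|r m| = L.
Proof.
rewrite /r fmorph_eq0 => r0; have n0 : 0 < `|rate m| by rewrite normr_gt0.
split; first by rewrite ltr0q divr_gt0 // subr_gt0 vmin_lt_vmax.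
by rewrite -ratr_norm -rmorphM /= /full_time mulfVK ?gt_eqF // rmorphB.
Qed.

Lemma cycle_costE i j : ratr (cycle_cost i j) =
  (ratr (cost_d i) + ratr (cost_d j) +
   (ratr (cost_c i) * ratr (full_time i) + ratr (cost_c j) * ratr (full_time j))) /
  (ratr (full_time i) + ratr (full_time j)) :> R.
Proof.
rewrite /cycle_cost; move: (full_time i) (full_time j) => ti tj.
by rewrite fmorph_div /= !rmorphD /= !rmorphM.
Qed.

Lemma var0 a : var a 0 = V (v0 S).
Proof. by rewrite /var big_ord0 addr0. Qed.

Lemma varS a k : var a k.+1 = var a k + (a k).2 * r (a k).1.
Proof. by rewrite /var big_ord_recr /= addrA. Qed.

Lemma v0_range : in_range S (V (v0 S)).
Proof. by rewrite /in_range !ler_rat v0_in. Qed.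

Lemma safe_range a : (forall i, 0 < (a i).2) -> safe (Infinite a) ->
  forall k, in_range S (var a k).
Proof.
move=> a0 hs k; have := hs k 0; rewrite /stays_safe mul0r addr0; apply.
by rewrite lexx ltW.
Qed.

(** During an action the variable is affine in time, hence lies between its values at the two
    ends. *)
Lemma safe_endpoints a : (forall k, in_range S (var a k)) -> safe (Infinite a).
Proof.
move=> hr k t /andP[t0 tk]; rewrite /stays_safe.
have := hr k; have := hr k.+1; rewrite varS /in_range -/(r _).
move: (var a k) (r _) => v q /andP[h1 h2] /andP[h3 h4].
apply/andP; have [q0|q0] := leP 0 q.
  have : 0 <= t * q by apply: mulr_ge0.
  have : t * q <= (a k).2 * q by apply: ler_wpM2r.
  by split; lra.
have : t * q <= 0 by rewrite nmulr_lle0.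
have : (a k).2 * q <= t * q by rewrite ler_nM2r.
by split; lra.
Qed.

(** Summed over the actions, the bounds of [slope_exists] telescope to [s] times the displacement of
    the variable, which is at most [L] in absolute value. The costs [x] and [d] are left general to
    serve both optimality and the nonexistence of schedules. *)
Lemma potential_bound (x d : mode S -> R) a :
  (forall m, 0 <= d m) -> (forall m, rate m = 0 -> 0 <= x m) ->
  (forall i j, 0 < rate i -> rate j < 0 ->
     0 <= d i + x i * ratr (full_time i) + (d j + x j * ratr (full_time j))) ->
  (forall i, 0 < (a i).2) -> safe (Infinite a) ->
  exists C : R, forall k,
    - C <= \sum_(i < k) (d (a i).1 + x (a i).1 * (a i).2).
Proof.
move=> hd hz hp a0 hs; have hr := safe_range a0 hs.
have [| | |s hsl] := @slope_exists _ r x d (fun m => ratr (full_time m)) L range_gt0 hd.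
- exact: full_timeP.
- by move=> m /eqP; rewrite fmorph_eq0 => /eqP; apply: hz.
- by move=> i j; rewrite ltr0q ltrq0; apply: hp.
exists (`|s| * L) => k.
apply: (@le_trans _ _ (\sum_(i < k) s * ((a i).2 * r (a i).1))); last first.
  apply: ler_sum => i _; apply: hsl; first exact: ltW.
  rewrite -{1}(gtr0_norm (a0 i)) -normrM.
  have -> : (a i).2 * r (a i).1 = var a i.+1 - var a i by rewrite varS; ring.
  have := hr i; have := hr i.+1; rewrite /in_range /L /V => /andP[h1 h2] /andP[h3 h4].
  by rewrite ler_norml; apply/andP; split; lra.
have -> : \sum_(i < k) s * ((a i).2 * r (a i).1) = s * (var a k - V (v0 S)).
  by rewrite /var -mulr_sumr /V; ring.
apply: (@le_trans _ _ (- `|s * (var a k - V (v0 S))|));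
  last by rewrite lerNl -normrN ler_norm.
rewrite lerN2 normrM ler_wpM2l //.
have := hr k; have := v0_range; rewrite /in_range /L /V => /andP[h1 h2] /andP[h3 h4].
by rewrite ler_norml; apply/andP; split; lra.
Qed.

Lemma forever_rate p m : safe (Forever p m : schedule R S) -> rate m = 0.
Proof.
case=> _ hs; apply/eqP/negPn/negP => r0.
have hr0 : r m != 0 by rewrite fmorph_eq0.
have rm : 0 < `|r m| by rewrite normr_gt0.
set a := nth (m, 0) p in hs *.
have ea : (a (size p)).1 = m by rewrite /a nth_default.
have h1 := hs 0 (lexx 0).
(* In this time the variable would move by [L + 1], more than the length of the range. *)
have T0 : 0 <= (L + 1) / `|r m|.
  by rewrite divr_ge0 // ltW // addr_gt0 // range_gt0.
have h2 := hs _ T0; move: h1 h2; rewrite /stays_safe ea -/(r m) mul0r addr0.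
rewrite /in_range -/(V _) => /andP[h1 h2] /andP[h3 h4].
have : `|(L + 1) / `|r m| * r m| <= L.
  by rewrite ler_norml; apply/andP; split; rewrite /L /V in h1 h2 h3 h4 *; lra.
rewrite normrM normf_div normr_id divfK ?normr_eq0 // ger0_norm; first by lra.
by have := range_gt0; lra.
Qed.

Lemma lower_bound (l : R) (s : schedule R S) :
  (forall m, rate m = 0 -> l <= ratr (cost_c m)) ->
  (forall i j, 0 < rate i -> rate j < 0 -> l <= ratr (cycle_cost i j)) ->
  safe_schedule s -> (l%:E <= limit_average_cost s)%E.
Proof.
move=> hz hp [hsch hs]; case: s hsch hs => [a [a0 hoo] hs|p m _ hs]; last first.
  by rewrite lee_fin; apply: hz; apply: forever_rate hs.
(* Charging [l] less per time unit turns the claim into a bound from below by a constant. *)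
have [| |i j hi hj|C hC] := @potential_bound (fun m => ratr (cost_c m) - l)
    (fun m => ratr (cost_d m)) a _ _ _ a0 hs.
- by move=> m; rewrite ler0q cost_d_ge0.
- by move=> m /hz; rewrite subr_ge0.
- have := hp i j hi hj; rewrite cycle_costE.
  have [|ti _] := @full_timeP i; first by rewrite fmorph_eq0 gt_eqF.
  have [|tj _] := @full_timeP j; first by rewrite fmorph_eq0 lt_eqF.
  rewrite ler_pdivlMr ?addr_gt0 // => h; lra.
have hT := sum_pinfty_unbounded a0 hoo.
(* Once the elapsed time is at least [C / e], the constant changes the average by at most [e]; the 1
   keeps the time positive whatever the sign of [C]. *)
apply: limn_esup_ge => e e0; have [N hN] := hT (Num.max 1 (C / e)).
exists N => k hk; have := hN k.+1 (leqW hk); rewrite ge_max => /andP[T1 T2].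
rewrite /average_cost ler_pdivlMr; last by apply: lt_le_trans T1.
set T := \sum_(i < k.+1) _ in T1 T2 *.
have := hC k.+1; rewrite ler_pdivrMr // in T2 => hk1.
have -> : \sum_(i < k.+1) (ratr (cost_d (a i).1) + ratr (cost_c (a i).1) * (a i).2)
   = \sum_(i < k.+1) (ratr (cost_d (a i).1) + (ratr (cost_c (a i).1) - l) * (a i).2)
     + l * T.
  by rewrite /T mulr_sumr -big_split /=; apply: eq_bigr => i _; ring.
lra.
Qed.

(** With cost -1 per time unit and free switching, the hypotheses of [potential_bound] hold
    vacuously, and its conclusion bounds the total time, which should be infinite. *)
Lemma no_schedule :
  (forall m : mode S, rate m <> 0) ->
  (forall i j : mode S, 0 < rate i -> rate j < 0 -> False) ->
  ~ exists s : schedule R S, safe_schedule s.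
Proof.
move=> hz hp [s [hsch hs]]; case: s hsch hs => [a [a0 hoo] hs|p m _ hs]; last first.
  exact: hz (forever_rate hs).
have [| |i j hi hj|C hC] := @potential_bound (fun m => -1) (fun m => 0) a _ _ _ a0 hs.
- by [].
- by move=> m /hz.
- by case: (hp i j hi hj).
have [N hN] := sum_pinfty_unbounded a0 hoo (C + 1).
have := hC N; have := hN N (leqnn N).
under [in X in _ -> X -> _]eq_bigr => i _ do rewrite add0r mulN1r.
by rewrite sumrN; lra.
Qed.

Lemma optimal_of_le (l : R) (s : schedule R S) :
  (forall m, rate m = 0 -> l <= ratr (cost_c m)) ->
  (forall i j, 0 < rate i -> rate j < 0 -> l <= ratr (cycle_cost i j)) ->
  safe_schedule s -> (limit_average_cost s <= l%:E)%E -> optimal s.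
Proof.
move=> hz hp hs hl; split=> // -[s' [hs' hlt]].
have := lt_le_trans hlt hl; rewrite ltNge => /negP; apply.
exact: lower_bound.
Qed.

Lemma stay_optimal m : rate m = 0 ->
  (forall m', rate m' = 0 -> cost_c m <= cost_c m') ->
  (forall i j, 0 < rate i -> rate j < 0 -> cost_c m <= cycle_cost i j) ->
  optimal (described R (Final [::] m)).
Proof.
move=> r0 hz hp; apply: (@optimal_of_le (ratr (cost_c m))) => //.
- by move=> m' h; rewrite ler_rat hz.
- by move=> i j hi hj; rewrite ler_rat hp.
split=> //; split=> // t t0; rewrite /stays_safe /= r0 rmorph0 mulr0 addr0.
by rewrite var0; apply: v0_range.
Qed.

(** The cycle starts at [vmax]. If the variable is there already, the prefix must be empty, since
    durations are positive. *)
Definition climb i : seq (mode S * rat) :=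
  if v0 S < vmax S then [:: (i, (vmax S - v0 S) / rate i)] else [::].

(** * The alternating schedule and its average cost *)

Section Cycle.
Variables i j : mode S.
Hypotheses (hi : 0 < rate i) (hj : rate j < 0).

Let ti : R := ratr (full_time i).
Let tj : R := ratr (full_time j).
Let lasso : description S := Lasso (climb i) (j, full_time j) [:: (i, full_time i)].
Let real (x : mode S * rat) : mode S * R := (x.1, ratr x.2).
Let a (n : nat) : mode S * R :=
  real (if (n < size (climb i))%N then nth (j, full_time j) (climb i) n
        else nth (j, full_time j) [:: (j, full_time j); (i, full_time i)]
               ((n - size (climb i)) %% 2)).

Lemma times_gt0 : 0 < ti /\ 0 < tj.
Proof.
split; first by have [|] := @full_timeP i; rewrite // fmorph_eq0 gt_eqF.
by have [|] := @full_timeP j; rewrite // fmorph_eq0 lt_eqF.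
Qed.

Lemma time_i : ti * r i = L.
Proof.
have [|_] := @full_timeP i; first by rewrite fmorph_eq0 gt_eqF.
by rewrite gtr0_norm // ltr0q.
Qed.

Lemma time_j : tj * r j = - L.
Proof.
have [|_] := @full_timeP j; first by rewrite fmorph_eq0 lt_eqF.
by rewrite ltr0_norm ?ltrq0 // mulrN => <-; rewrite opprK.
Qed.

Lemma cycle_action k :
  a (size (climb i) + k) = if odd k then (i, ti) else (j, tj).
Proof.
rewrite /a ltnNge leq_addr /= addKn modn2.
by case: (odd k).
Qed.

Lemma cycle_var k :
  var a (size (climb i) + k) = if odd k then V (vmin S) else V (vmax S).
Proof.
elim: k => [|k IHk].
  rewrite addn0 /= /a /climb; have [h|h] := boolP (v0 S < vmax S) => /=.
    rewrite varS var0 /= rmorphM fmorphV rmorphB /= -/(r i) divfK.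
      by rewrite /V; ring.
    by rewrite fmorph_eq0 gt_eqF.
  rewrite -leNgt in h; rewrite var0; congr V; apply/eqP; rewrite eq_le h andbT.
  by have /andP[] := v0_in S.
rewrite addnS varS IHk cycle_action /=; case: (odd k) => /=.
  by rewrite time_i /L; ring.
by rewrite time_j /L; ring.
Qed.

Lemma cycle_range k : in_range S (var a k).
Proof.
have [h|h] := leqP (size (climb i)) k.
  rewrite -(subnKC h) cycle_var /in_range /V.
  have := ltW (vmin_lt_vmax S); rewrite -(ler_rat R) => hle.
  by case: odd; rewrite lexx ?andbT.
have -> : k = 0%N by move: h; rewrite /climb; case: ifP; case: k.
by rewrite var0; apply: v0_range.
Qed.

Lemma cycle_times : exists2 tau : R, 0 < tau & forall n, tau <= (a n).2.
Proof.
have [ti0 tj0] := times_gt0.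
pose tp : R := if v0 S < vmax S then ratr ((vmax S - v0 S) / rate i) else 1.
have tp0 : 0 < tp.
  by rewrite /tp; case: ifP => // h; rewrite ltr0q divr_gt0 ?subr_gt0.
exists (Num.min tp (Num.min ti tj)); first by rewrite !lt_min tp0 ti0 tj0.
move=> n; have [h|h] := leqP (size (climb i)) n.
  rewrite -(subnKC h) cycle_action.
  by case: odd; rewrite !ge_min lexx ?orbT.
rewrite ge_min /a h; apply/orP; left; move: h; rewrite /climb /tp.
by case: ifP => //; case: n.
Qed.

Lemma cycle_safe : safe_schedule (described R lasso).
Proof.
have [tau tau0 ht] := cycle_times.
split; last exact: (@safe_endpoints a cycle_range).
split; first by move=> n; apply: lt_le_trans (ht n).
exact: sum_unbounded_pinfty tau0 ht.
Qed.

(** For the reduced costs [g], the two actions of a period cancel, so after the prefix the partial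
    sums take only the values [P] and [P + g j tj]. The cost thus exceeds [l T] by at most a
    constant, which disappears in the average. *)
Lemma cycle_average :
  (limit_average_cost (described R lasso) <= (ratr (cycle_cost i j))%:E)%E.
Proof.
set l : R := ratr _; have [ti0 tj0] := times_gt0.
have [tau tau0 ht] := cycle_times.
have a0 n : 0 < (a n).2 by apply: lt_le_trans (ht n).
have hT := sum_pinfty_unbounded a0 (sum_unbounded_pinfty tau0 ht).
pose g m t : R := ratr (cost_d m) + (ratr (cost_c m) - l) * t.
have hg : g i ti + g j tj = 0.
  have t0 : ti + tj != 0 by rewrite gt_eqF // addr_gt0.
  have : l * (ti + tj) = ratr (cost_d i) + ratr (cost_d j) +
      (ratr (cost_c i) * ti + ratr (cost_c j) * tj).
    by rewrite /l cycle_costE -/ti -/tj divfK.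
  by rewrite /g => h; lra.
pose P := \sum_(n < size (climb i)) g (a n).1 (a n).2.
have hP k : \sum_(n < size (climb i) + k) g (a n).1 (a n).2 =
            P + (if odd k then g j tj else 0).
  elim: k => [|k IHk]; first by rewrite addn0 addr0.
  have -> : \sum_(n < size (climb i) + k.+1) g (a n).1 (a n).2 =
      \sum_(n < size (climb i) + k) g (a n).1 (a n).2 +
      g (a (size (climb i) + k)).1 (a (size (climb i) + k)).2.
    by rewrite addnS big_ord_recr.
  rewrite IHk cycle_action oddS; case: (odd k) => /=; last by ring.
  by rewrite -addrA [g j tj + _]addrC hg.
pose C := P + `|g j tj|.
have hC k : (size (climb i) <= k)%N -> \sum_(n < k) g (a n).1 (a n).2 <= C.
  move=> h; rewrite -(subnKC h) hP lerD2l.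
  by case: odd; rewrite ?ler_norm // normr_ge0.
apply: limn_esup_le => e e0; have [N hN] := hT (Num.max 1 (C / e)).
exists (N + size (climb i))%N => k hk.
have hk1 : (N <= k.+1)%N by lia.
have := hN _ hk1; rewrite ge_max => /andP[T1 T2].
rewrite /average_cost -/a ler_pdivrMr; last by apply: lt_le_trans T1.
set T := \sum_(n < k.+1) _ in T1 T2 *.
have hk2 : (size (climb i) <= k.+1)%N by lia.
have := hC _ hk2; rewrite ler_pdivrMr // in T2 => hk3.
have -> : \sum_(n < k.+1) (ratr (cost_d (a n).1) + ratr (cost_c (a n).1) * (a n).2)
   = \sum_(n < k.+1) g (a n).1 (a n).2 + l * T.
  by rewrite /T mulr_sumr -big_split /=; apply: eq_bigr => n _; rewrite /g; ring.
lra.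
Qed.

Lemma cycle_optimal :
  (forall m, rate m = 0 -> cycle_cost i j <= cost_c m) ->
  (forall i' j', 0 < rate i' -> rate j' < 0 -> cycle_cost i j <= cycle_cost i' j') ->
  optimal (described R lasso).
Proof.
move=> hz hp; apply: optimal_of_le cycle_safe cycle_average.
- by move=> m h; rewrite ler_rat hz.
- by move=> i' j' hi' hj'; rewrite ler_rat hp.
Qed.

End Cycle.
End Potential.

(** * The search for the best candidate *)

Section Fractions.
Definition int_frac : Type := (int * int)%type.
Implicit Types x y : int_frac.

Definition fadd x y : int_frac := (x.1 * y.2 + y.1 * x.2, x.2 * y.2).
Definition fsub x y : int_frac := (x.1 * y.2 - y.1 * x.2, x.2 * y.2).
Definition fmul x y : int_frac := (x.1 * y.1, x.2 * y.2).
Definition fdiv x y : int_frac := (x.1 * y.2, x.2 * y.1).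
Definition fle x y : bool := x.1 * y.2 <= y.1 * x.2.
Definition flt x y : bool := x.1 * y.2 < y.1 * x.2.

Definition denotes x (r : rat) : Prop := 0 < x.2 /\ r = x.1%:~R / x.2%:~R.

Lemma denotes_den x r : denotes x r -> (x.2%:~R : rat) != 0.
Proof. by case=> h _; rewrite intr_eq0 gt_eqF. Qed.

Lemma denotes_add x y r s : denotes x r -> denotes y s -> denotes (fadd x y) (r + s).
Proof.
move=> hx hy; split; first by case: hx hy => a _ [b _]; apply: mulr_gt0.
have := denotes_den hx; have := denotes_den hy; case: hx hy => _ -> [_ ->] /=.
by rewrite intrD !intrM => a b; field; rewrite a b.
Qed.

Lemma denotes_sub x y r s : denotes x r -> denotes y s -> denotes (fsub x y) (r - s).
Proof.
move=> hx hy; split; first by case: hx hy => a _ [b _]; apply: mulr_gt0.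
have := denotes_den hx; have := denotes_den hy; case: hx hy => _ -> [_ ->] /=.
by rewrite intrB !intrM => a b; field; rewrite a b.
Qed.

Lemma denotes_mul x y r s : denotes x r -> denotes y s -> denotes (fmul x y) (r * s).
Proof.
move=> hx hy; split; first by case: hx hy => a _ [b _]; apply: mulr_gt0.
have := denotes_den hx; have := denotes_den hy; case: hx hy => _ -> [_ ->] /=.
by rewrite !intrM => a b; field; rewrite a b.
Qed.

Lemma denotes_num_gt0 x r : denotes x r -> (0 < x.1) = (0 < r).
Proof. by case=> h ->; rewrite pmulr_lgt0 ?invr_gt0 ?ltr0z. Qed.

Lemma denotes_num_ge0 x r : denotes x r -> (0 <= x.1) = (0 <= r).
Proof. by case=> h ->; rewrite pmulr_lge0 ?invr_gt0 ?ltr0z // ler0z. Qed.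

(** The numerator of the divisor moves into the denominator, which must stay positive. *)
Lemma denotes_div x y r s : 0 < s -> denotes x r -> denotes y s ->
  denotes (fdiv x y) (r / s).
Proof.
move=> s0 hx hy; have y0 : 0 < y.1 by rewrite (denotes_num_gt0 hy).
split; first by case: hx => a _; apply: mulr_gt0.
have := denotes_den hx; have := denotes_den hy.
have y1 : (y.1%:~R : rat) != 0 by rewrite intr_eq0 gt_eqF.
case: hx hy => _ -> [_ ->] /=.
by rewrite !intrM => a b; field; rewrite a b y1.
Qed.

Lemma fltE x y r s : denotes x r -> denotes y s -> flt x y = (r < s).
Proof.
case=> hx -> [hy ->].
rewrite ltr_pdivrMr ?ltr0z // mulrAC ltr_pdivlMr ?ltr0z //.
by rewrite -!intrM ltr_int.
Qed.

Lemma fleE x y r s : denotes x r -> denotes y s -> fle x y = (r <= s).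
Proof.
by move=> hx hy; rewrite leNgt -(fltE hy hx) /flt /fle leNgt.
Qed.

End Fractions.

(** * Candidates as functions of the input word *)

Section Candidates.
Variable w : word.

Definition field (t : nat) : int_frac :=
  ((if tok_neg w t then - (tok_val w t)%:Z else (tok_val w t)%:Z),
   (tok_val w t.+1)%:Z).

(** For divisors: with the absolute rate, the denominator produced by [fdiv] is positive in
    descending modes as well. *)
Definition abs_field (t : nat) : int_frac := ((tok_val w t)%:Z, (tok_val w t.+1)%:Z).

Definition base (i : nat) : nat := (6 + 6 * i)%N.

Definition sweep_time (i : nat) : int_frac :=
  fdiv (fsub (field 2) (field 0)) (abs_field (base i)).

Definition climb_time (i : nat) : int_frac :=
  fdiv (fsub (field 2) (field 4)) (abs_field (base i)).

Definition sweep_cost (i j : nat) : int_frac :=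
  fdiv (fadd (fadd (field (base i).+4) (field (base j).+4))
             (fadd (fmul (field (base i).+2) (sweep_time i))
                   (fmul (field (base j).+2) (sweep_time j))))
       (fadd (sweep_time i) (sweep_time j)).

(** The input does not state the number of modes; a mode is present when its six tokens are. *)
Definition is_index (i : nat) : bool := (base i.+1 <= size (toks w))%N.
Definition null_rate (i : nat) : bool := tok_val w (base i) == 0%N.
(** Zero may be written with a minus sign, so the sign alone does not decide. *)
Definition pos_rate (i : nat) : bool := ~~ tok_neg w (base i) && ~~ null_rate i.
Definition neg_rate (i : nat) : bool := tok_neg w (base i) && ~~ null_rate i.

(* The pair [(i, i)] stands for staying for ever in mode [i], and [(i, j)] with
   [i <> j] for the cycle that ascends in mode [i] and descends in mode [j]. *)
Definition candidate (i j : nat) : bool :=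
  [&& is_index i, is_index j &
      if i == j then null_rate i else pos_rate i && neg_rate j].

Definition candidate_cost (i j : nat) : int_frac :=
  if i == j then field (base i).+2 else sweep_cost i j.

Definition best (i j : nat) : bool :=
  candidate i j &&
  all (fun i' => all (fun j' => candidate i' j' ==>
    fle (candidate_cost i j) (candidate_cost i' j')) (iota 0 (size w)))
    (iota 0 (size w)).

(** Searching below [size w] suffices by [index_lt]. The default value [size w] of [find] reports
    that there is no candidate. *)
Definition best_up : nat :=
  find (fun i => has (best i) (iota 0 (size w))) (iota 0 (size w)).
Definition best_down : nat := find (best best_up) (iota 0 (size w)).

End Candidates.

(** * Agreement of the search with the coded system *)

Section Correctness.
Variables (S : system) (w : word).
Hypothesis hw : system_code S w.
Implicit Types m i j : mode S.

Lemma tok_field_denotes r t : tok_field w r t ->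
  denotes (field w t) r /\ denotes (abs_field w t) `|r|.
Proof.
case=> h0 ->; rewrite /denotes /field /abs_field /= ltz_nat h0.
split; split=> //.
  by case: tok_neg; rewrite ?expr1 ?expr0 ?mulN1r ?mul1r ?intrN ?mulNr.
by rewrite normrM normrX normrN1 expr1n mul1r ger0_norm.
Qed.

Lemma mode_fields m : [/\ denotes (field w (base (enum_rank m))) (rate m),
  denotes (abs_field w (base (enum_rank m))) `|rate m|,
  denotes (field w (base (enum_rank m)).+2) (cost_c m)
  & denotes (field w (base (enum_rank m)).+4) (cost_d m)].
Proof.
have [_ _ _ _ h] := system_code_toks hw; have [h1 h2 h3] := h m.
by split; [have [] := tok_field_denotes h1|have [] := tok_field_denotes h1|
  have [] := tok_field_denotes h2|have [] := tok_field_denotes h3].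
Qed.

Lemma null_rateE m : null_rate w (enum_rank m) = (rate m == 0).
Proof.
have [_ [h1 h2] _ _] := mode_fields m; rewrite -normr_eq0 h2 mulf_eq0 invr_eq0.
by rewrite !intr_eq0 (gt_eqF h1) orbF.
Qed.

Lemma pos_rateE m : pos_rate w (enum_rank m) = (0 < rate m).
Proof.
have [h _ _ _] := mode_fields m; rewrite -(denotes_num_gt0 h) /pos_rate /null_rate.
by rewrite /field /=; case: tok_neg => /=; [lia|case: eqP; lia].
Qed.

Lemma neg_rateE m : neg_rate w (enum_rank m) = (rate m < 0).
Proof.
have [h _ _ _] := mode_fields m.
rewrite ltNge -(denotes_num_ge0 h) /neg_rate /null_rate.
by rewrite /field /=; case: tok_neg => /=; [case: eqP; lia|lia].
Qed.

Lemma range_fields :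
  [/\ denotes (field w 0) (vmin S), denotes (field w 2) (vmax S)
    & denotes (field w 4) (v0 S)].
Proof.
have [_ h1 h2 h3 _] := system_code_toks hw.
by split; [have [] := tok_field_denotes h1|have [] := tok_field_denotes h2|
  have [] := tok_field_denotes h3].
Qed.

Lemma sweep_timeP m : rate m != 0 -> denotes (sweep_time w (enum_rank m)) (full_time m).
Proof.
move=> r0; have [_ h _ _] := mode_fields m; have [h1 h2 _] := range_fields.
apply: denotes_div => //; first by rewrite normr_gt0.
exact: denotes_sub.
Qed.

Lemma climb_timeP m : 0 < rate m ->
  denotes (climb_time w (enum_rank m)) ((vmax S - v0 S) / rate m).
Proof.
move=> r0; have [_ h _ _] := mode_fields m; have [_ h1 h2] := range_fields.
rewrite gtr0_norm // in h.
by apply: denotes_div => //; apply: denotes_sub.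
Qed.

Lemma full_time_gt0 m : rate m != 0 -> 0 < full_time m.
Proof.
by move=> r0; rewrite divr_gt0 ?normr_gt0 // subr_gt0 vmin_lt_vmax.
Qed.

Lemma sweep_costP i j : rate i != 0 -> rate j != 0 ->
  denotes (sweep_cost w (enum_rank i) (enum_rank j)) (cycle_cost i j).
Proof.
move=> ri rj; have [_ _ ci di] := mode_fields i; have [_ _ cj dj] := mode_fields j.
have ti := sweep_timeP ri; have tj := sweep_timeP rj.
apply: denotes_div; first by rewrite addr_gt0 // full_time_gt0.
  by apply: denotes_add; apply: denotes_add => //; apply: denotes_mul.
exact: denotes_add.
Qed.

Lemma is_indexP (k : nat) : reflect (exists m, k = enum_rank m) (is_index w k).
Proof.
have [hs _ _ _ _] := system_code_toks hw.
rewrite /is_index hs /base; apply: (iffP idP) => [h|[m ->]].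
  have hk : (k < #|mode S|)%N by lia.
  by exists (enum_val (Ordinal hk)); rewrite enum_valK.
by rewrite leq_add2l leq_mul2l ltn_ord.
Qed.

Lemma index_lt (k : nat) : is_index w k -> (k < size w)%N.
Proof.
rewrite /is_index size_toks /base => h.
suff : (delims w (size w) <= size w)%N by lia.
rewrite /delims; apply: (@leq_trans (\sum_(0 <= q < size w) 1)%N).
  by apply: leq_sum => q _; case: letter_at.
by rewrite sum_nat_const_nat subn0 muln1.
Qed.

Definition cost_of i j : rat := if i == j then cost_c i else cycle_cost i j.

Definition is_candidate i j : bool :=
  if i == j then rate i == 0 else (0 < rate i) && (rate j < 0).

Lemma enum_rank_eq i j : (enum_rank i == enum_rank j :> nat) = (i == j).
Proof. by rewrite -(inj_eq (@enum_rank_inj _)). Qed.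

Lemma candidateE i j : candidate w (enum_rank i) (enum_rank j) = is_candidate i j.
Proof.
have hI m : is_index w (enum_rank m) by apply/is_indexP; exists m.
by rewrite /candidate !hI enum_rank_eq null_rateE pos_rateE neg_rateE.
Qed.

Lemma candidate_costP i j : is_candidate i j ->
  denotes (candidate_cost w (enum_rank i) (enum_rank j)) (cost_of i j).
Proof.
rewrite /is_candidate /candidate_cost /cost_of enum_rank_eq;
  case: eqP => [_ _|_ /andP[hi hj]].
  by have [] := mode_fields i.
by apply: sweep_costP; [rewrite gt_eqF|rewrite lt_eqF].
Qed.

Lemma candidate_modes (a b : nat) : candidate w a b ->
  exists i j, [/\ a = enum_rank i, b = enum_rank j & is_candidate i j].
Proof.
move=> h; have /and3P[/is_indexP[i ei] /is_indexP[j ej] _] := h.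
by exists i, j; rewrite -candidateE -ei -ej.
Qed.

Lemma bestP i j :
  reflect (is_candidate i j /\ forall i' j', is_candidate i' j' ->
    cost_of i j <= cost_of i' j')
          (best w (enum_rank i) (enum_rank j)).
Proof.
rewrite /best candidateE; apply: (iffP andP) => -[hc h]; split=> //.
  move=> i' j' hc'; rewrite -(fleE (candidate_costP hc) (candidate_costP hc')).
  have hcw : candidate w (enum_rank i') (enum_rank j') by rewrite candidateE.
  have /and3P[li lj _] := hcw.
  move/allP: h => /(_ (enum_rank i')); rewrite mem_iota index_lt // => /(_ isT).
  move=> /allP /(_ (enum_rank j')); rewrite mem_iota index_lt // => /(_ isT).
  by rewrite hcw.
apply/allP => a _; apply/allP => b _;
  apply/implyP => /candidate_modes[i' [j' [-> -> hc']]].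
by rewrite (fleE (candidate_costP hc) (candidate_costP hc')); apply: h.
Qed.

Lemma best_exists i j : is_candidate i j ->
  exists i' j', best w (enum_rank i') (enum_rank j').
Proof.
move=> h; pose P (x : mode S * mode S) := is_candidate x.1 x.2.
have [x hx hmin] := @arg_minP _ _ _ (i, j) P (fun x => cost_of x.1 x.2) h.
exists x.1, x.2; apply/bestP; split=> // i' j' h'.
exact: (hmin (i', j')).
Qed.

Lemma best_lt a b : best w a b -> (a < size w)%N /\ (b < size w)%N.
Proof. by case/andP=> /and3P[ha hb _] _; split; apply: index_lt. Qed.

Lemma best_found : (best_up w < size w)%N ->
  exists i j, [/\ best_up w = enum_rank i, best_down w = enum_rank j
                & best w (enum_rank i) (enum_rank j)].
Proof.
move=> h.
have h1 : has (fun a => has (best w a) (iota 0 (size w))) (iota 0 (size w)).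
  by rewrite has_find size_iota.
have h2 := nth_find 0%N h1; rewrite nth_iota // add0n -/(best_up w) in h2.
have h3 := nth_find 0%N h2; rewrite -/(best_down w) in h3.
have h4 : (best_down w < size w)%N by move: h2; rewrite has_find size_iota.
rewrite nth_iota // add0n in h3.
have /andP[hc _] := h3; have [i [j [ei ej _]]] := candidate_modes hc.
by exists i, j; rewrite -ei -ej.
Qed.

Lemma best_not_found i j : (size w <= best_up w)%N -> ~ is_candidate i j.
Proof.
move=> h /best_exists[i' [j' hb]]; have [ha hb'] := best_lt hb.
have : has (fun a => has (best w a) (iota 0 (size w))) (iota 0 (size w)).
  apply/hasP; exists (enum_rank i' : nat); first by rewrite mem_iota.
  by apply/hasP; exists (enum_rank j' : nat); rewrite // mem_iota.
by rewrite has_find size_iota ltnNge -/(best_up w) h.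
Qed.

End Correctness.

(** * Computing the output *)

Section CandidatesComputable.
Notation LS := (@LS symbol symbol).
Notation BN := (@BN symbol symbol).
Implicit Types (i j t : word -> seq nat -> nat) (X Y : word -> seq nat -> int_frac).

Definition BF X : Prop := BN (fun w e => (X w e).1) /\ BN (fun w e => (X w e).2).

Lemma BF_add X Y : BF X -> BF Y -> BF (fun w e => fadd (X w e) (Y w e)).
Proof.
by case=> x1 x2 [y1 y2]; split; [apply: BN_add; apply: BN_mul|apply: BN_mul].
Qed.

Lemma BF_sub X Y : BF X -> BF Y -> BF (fun w e => fsub (X w e) (Y w e)).
Proof.
by case=> x1 x2 [y1 y2]; split; [apply: BN_sub; apply: BN_mul|apply: BN_mul].
Qed.

Lemma BF_mul X Y : BF X -> BF Y -> BF (fun w e => fmul (X w e) (Y w e)).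
Proof. by case=> x1 x2 [y1 y2]; split; apply: BN_mul. Qed.

Lemma BF_div X Y : BF X -> BF Y -> BF (fun w e => fdiv (X w e) (Y w e)).
Proof. by case=> x1 x2 [y1 y2]; split; apply: BN_mul. Qed.

Lemma BF_if (P : word -> seq nat -> bool) X Y :
  LS (fun w e => nat_of_bool (P w e)) -> BF X -> BF Y ->
  BF (fun w e => if P w e then X w e else Y w e).
Proof.
move=> hP [x1 x2] [y1 y2]; split.
  by apply: BN_ext (BN_if hP x1 y1) => w e; case: (P w e).
by apply: BN_ext (BN_if hP x2 y2) => w e; case: (P w e).
Qed.

Lemma LS_fle X Y : BF X -> BF Y -> LS (fun w e => nat_of_bool (fle (X w e) (Y w e))).
Proof. by case=> x1 x2 [y1 y2]; apply: LS_lez; apply: BN_mul. Qed.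

Lemma LS_flt X Y : BF X -> BF Y -> LS (fun w e => nat_of_bool (flt (X w e) (Y w e))).
Proof. by case=> x1 x2 [y1 y2]; apply: LS_ltz; apply: BN_mul. Qed.

Lemma BF_abs_field t : LS t -> BF (fun w e => abs_field w (t w e)).
Proof. by move=> ht; split; apply: BN_tok_val => //; apply: LS_succ. Qed.

Lemma BF_field t : LS t -> BF (fun w e => field w (t w e)).
Proof.
move=> ht; have [h1 h2] := BF_abs_field ht; split=> //.
apply: BN_if => //; first exact: LS_tok_neg.
exact: BN_opp.
Qed.

Lemma LS_base i : LS i -> LS (fun w e => base (i w e)).
Proof. by move=> hi; apply: LS_add; [|apply: LS_mul] => //; apply: LS_const. Qed.

Lemma BF_sweep_time i : LS i -> BF (fun w e => sweep_time w (i w e)).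
Proof.
move=> hi; apply: BF_div; last by apply/BF_abs_field/LS_base.
by apply: BF_sub; apply: BF_field; apply: LS_const.
Qed.

Lemma BF_climb_time i : LS i -> BF (fun w e => climb_time w (i w e)).
Proof.
move=> hi; apply: BF_div; last by apply/BF_abs_field/LS_base.
by apply: BF_sub; apply: BF_field; apply: LS_const.
Qed.

Lemma BF_cost_c i : LS i -> BF (fun w e => field w (base (i w e)).+2).
Proof. by move=> hi; apply: BF_field; do 2!apply: LS_succ; apply: LS_base. Qed.

Lemma BF_cost_d i : LS i -> BF (fun w e => field w (base (i w e)).+4).
Proof. by move=> hi; apply: BF_field; do 4!apply: LS_succ; apply: LS_base. Qed.

Lemma BF_candidate_cost i j : LS i -> LS j ->
  BF (fun w e => candidate_cost w (i w e) (j w e)).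
Proof.
move=> hi hj; apply: BF_if; [exact: LS_eqn|exact: BF_cost_c|].
have ti := BF_sweep_time hi; have tj := BF_sweep_time hj.
apply: BF_div; last exact: BF_add.
apply: BF_add; first by apply: BF_add; apply: BF_cost_d.
by apply: BF_add; apply: BF_mul => //; apply: BF_cost_c.
Qed.

Lemma LS_is_index i : LS i -> LS (fun w e => nat_of_bool (is_index w (i w e))).
Proof.
by move=> hi; apply: LS_leq; [apply: LS_base; apply: LS_succ|apply: LS_size_toks].
Qed.

Lemma LS_null_rate i : LS i -> LS (fun w e => nat_of_bool (null_rate w (i w e))).
Proof.
move=> hi; apply: (LS_ext _
  (LS_eqz (BN_tok_val (LS_base hi)) (BN_nat (LS_const _ _ 0)))).
by [].
Qed.

Lemma LS_candidate i j : LS i -> LS j ->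
  LS (fun w e => nat_of_bool (candidate w (i w e) (j w e))).
Proof.
move=> hi hj; apply: LS_and; first exact: LS_is_index.
apply: LS_and; first exact: LS_is_index.
have hn k : LS k -> LS (fun w e => nat_of_bool (tok_neg w (base (k w e)))).
  by move=> hk; apply: LS_tok_neg; apply: LS_base.
have hp : LS (fun w e => nat_of_bool (pos_rate w (i w e) && neg_rate w (j w e))).
  apply: LS_and; apply: LS_and.
  - by apply: LS_not; apply: hn.
  - by apply: LS_not; apply: LS_null_rate.
  - exact: hn.
  - by apply: LS_not; apply: LS_null_rate.
apply: LS_ext (LS_if (LS_eqn hi hj) (LS_null_rate hi) hp) => w e.
by case: (_ == _).
Qed.

Lemma LS_best i j : LS i -> LS j ->
  LS (fun w e => nat_of_bool (best w (i w e) (j w e))).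
Proof.
move=> hi hj; apply: LS_and; first exact: LS_candidate.
apply: LS_all; first exact: LS_size.
apply: LS_all; first exact: LS_size.
apply: LS_imp; first exact: LS_candidate (LS_var1 _ _) (LS_head _ _).
apply: LS_fle; last exact: BF_candidate_cost (LS_var1 _ _) (LS_head _ _).
exact: BF_candidate_cost (LS_wk_iter 2 hi) (LS_wk_iter 2 hj).
Qed.

Lemma LS_best_up : LS (fun w _ => best_up w).
Proof.
apply: LS_find; first exact: LS_size.
apply: LS_has; first exact: LS_size.
exact: LS_best (LS_var1 _ _) (LS_head _ _).
Qed.

Lemma LS_best_down : LS (fun w _ => best_down w).
Proof.
apply: LS_find; first exact: LS_size.
exact: LS_best LS_best_up (LS_head _ _).
Qed.

Section Output.
Notation LSO := (@LSO symbol symbol).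

Lemma LSO_seq (u : word) : LSO (fun _ _ => u).
Proof.
elim: u => [|a u IHu]; first exact: LSO_nil.
exact: (LSO_cat (LSO_emit _ a) IHu).
Qed.

Lemma LSO_index i : LS i -> exists f : word -> seq nat -> word,
  LSO f /\ forall w e, nat_code (i w e) (f w e).
Proof.
move=> hi; have [bs [h1 h2]] := LSO_binary Bit (BN_nat hi).
exists (fun w e => map Bit (bs w e)); split=> // w e.
by have [//|h3 [h4]] := h2 w e; exists (bs w e).
Qed.

Lemma LSO_frac X : BF X -> exists f : word -> seq nat -> word,
  LSO f /\ forall w e r, denotes (X w e) r -> 0 <= r -> rat_code r (f w e).
Proof.
case=> hx hy; have [bx [h1 h2]] := LSO_binary Bit hx.
have [bY [h3 h4]] := LSO_binary Bit hy.
exists (fun w e => map Bit (bx w e) ++ [:: Slash] ++ map Bit (bY w e)); split.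
  by apply: LSO_cat => //; apply: LSO_cat => //; apply: LSO_seq.
move=> w e r hd r0; have [d0 er] := hd.
have n0 : 0 <= (X w e).1 by rewrite (denotes_num_ge0 hd).
have [a1 a2] := h2 w e n0; have [a3 a4] := h4 w e (ltW d0).
exists false, (msb_val (bx w e)), (msb_val (bY w e)).
exists (map Bit (bx w e)), (map Bit (bY w e)).
split=> //.
- by exists (bx w e).
- by exists (bY w e).
- by rewrite -ltz_nat a4.
- by rewrite mul1r er -a2 -a4.
Qed.

(** The printing function is fixed before the system is: one program serves all instances. *)
Lemma LSO_action i X : LS i -> BF X -> exists f : word -> seq nat -> word,
  LSO f /\ forall (S : system) w e (m : mode S) r,
    i w e = enum_rank m -> denotes (X w e) r -> 0 <= r -> action_code (m, r) (f w e).
Proof.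
move=> hi hX; have [fi [h1 h2]] := LSO_index hi; have [fX [h3 h4]] := LSO_frac hX.
exists (fun w e => [:: Semicolon] ++ fi w e ++ [:: Comma] ++ fX w e); split.
  by do 3!(apply: LSO_cat => //; first try exact: LSO_seq).
move=> S w e m r hm hd r0; exists (fi w e), (fX w e); split=> //=.
  by rewrite -hm.
exact: h4.
Qed.

End Output.
End CandidatesComputable.

Theorem theorem6 (R : realType) :
  logspace_solvable system_code (@optimal_schedule_code R).
Proof.
have [fi [hfi pi]] := LSO_index LS_best_up.
have [fc [hfc pc]] := LSO_action LS_best_up (BF_climb_time LS_best_up).
have [fd [hfd pd]] := LSO_action LS_best_down (BF_sweep_time LS_best_down).
have [fu [hfu pu]] := LSO_action LS_best_up (BF_sweep_time LS_best_up).
(* Equal indices mean staying for ever in one mode. The prefix is printed under the same test, of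
   the initial value against [vmax], that defines [climb]. *)
pose out w e : word :=
  if (best_up w < size w)%N then
    if best_up w == best_down w then
      [:: Semicolon] ++ fi w e ++ [:: Comma; Infty]
    else (if flt (field w 4) (field w 2) then fc w e else [::]) ++
         [:: Bar] ++ fd w e ++ fu w e
  else [::].
have hout : @LSO symbol symbol out.
  apply: LSO_if; last exact: LSO_seq.
    exact: LS_ltn LS_best_up (LS_size _ _).
  apply: LSO_if; first exact: LS_eqn LS_best_up LS_best_down.
    by apply: LSO_cat; [|apply: LSO_cat => //]; apply: LSO_seq.
  apply: LSO_cat; last by apply: LSO_cat; [apply: LSO_seq|apply: LSO_cat].
  apply: LSO_if => //; last exact: LSO_seq.
  by apply: LS_flt; apply: BF_field; apply: LS_const.
have [T [hT hv]] := LSO_logspace hout.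
exists T; split=> // S w hw; exists (out w [::]); split; first exact: hv.
rewrite /out; case: ltnP => hup; last first.
  have none := best_not_found hw hup.
  right; split=> //; have h0 (m : mode S) : rate m <> 0.
    by move=> hm; apply: (none m m); rewrite /is_candidate eqxx hm.
  apply: (no_schedule h0) => i j hi hj; apply: (none i j); rewrite /is_candidate.
  by case: eqP hi hj => [->|_] hi hj; [have := lt_trans hi hj; rewrite ltxx|rewrite hi].
left; have [i [j [ei ej hb]]] := best_found hw hup.
have [hc hmin] := elimT (bestP hw i j) hb.
rewrite ei ej (enum_rank_eq i j).
have hz (m : mode S) : rate m = 0 -> cost_of i j <= cost_c m.
  move=> hm; have := hmin m m; rewrite /is_candidate /cost_of eqxx hm; exact.
have hp (i' j' : mode S) : 0 < rate i' -> rate j' < 0 ->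
  cost_of i j <= cycle_cost i' j'.
  move=> hi hj; have := hmin i' j'; rewrite /is_candidate [cost_of i' j']/cost_of.
  case: eqP hi hj => [->|_] hi hj; first by have := lt_trans hi hj; rewrite ltxx.
  by rewrite hi hj; apply.
case: (i =P j) hc hz hp => [<-|hij]; rewrite /is_candidate /cost_of.
  rewrite eqxx => /eqP r0 hz hp; exists (Final [::] i); split.
    by exists [::], (fi w [::]); split=> //; rewrite -ei; apply: pi.
  exact: stay_optimal.
have -> : (i == j) = false by apply/eqP.
move=> /andP[hi hj] hz hp.
exists (Lasso (climb i) (j, full_time j) [:: (i, full_time i)]); split; last first.
  exact: cycle_optimal.
have ri : rate i != 0 by rewrite gt_eqF.
have rj : rate j != 0 by rewrite lt_eqF.
have [_ hmax h0] := range_fields hw.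
exists (if flt (field w 4) (field w 2) then fc w [::] else [::]).
exists (fd w [::] ++ fu w [::]).
split=> //.
  rewrite (fltE h0 hmax) /climb; case: ifP => // hlt.
  exists (fc w [::]), [::]; split; rewrite ?cats0 //.
  apply: pc => //; first by rewrite ei; apply: climb_timeP hw _ hi.
  by rewrite divr_ge0 ?subr_ge0 ?ltW.
exists (fd w [::]), (fu w [::]); split=> //.
  apply: pd => //; first by rewrite ej; apply: sweep_timeP hw _ rj.
  exact/ltW/full_time_gt0.
exists (fu w [::]), [::]; split; rewrite ?cats0 //.
apply: pu => //; first by rewrite ei; apply: sweep_timeP hw _ ri.
exact/ltW/full_time_gt0.
Qed.
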